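(* Let $\Pi$ be a topological parallelism on $\mathrm{PG}(3,\mathbb{R})$ with (full) automorphism group $\Phi=\operatorname{Aut}\Pi\le \mathrm{PGL}(4,\mathbb{R})$. Then the identity component $\Phi^1$ of $\Phi$ is compact, and hence is conjugate (in $\mathrm{PGL}(4,\mathbb{R})$) to a closed, connected subgroup of $\mathrm{PSO}(4,\mathbb{R})$.
   Context: Real projective 3-space $\mathrm{PG}(3,\mathbb{R})$ has point space $P$ (the 1-dimensional subspaces of $\mathbb{R}^4$) and line space $\mathcal{L}$ (the 2-dimensional subspaces of $\mathbb{R}^4$), both with the usual Grassmann manifold topology. A parallelism $\Pi$ is an equivalence relation on $\mathcal{L}$ (equivalent lines are called parallel) such that for every $(p,L)\in P\times\mathcal{L}$ there is a unique line, denoted $\Pi(p,L)$, which passes through $p$ and is parallel to $L$. It is topological if the map $\Pi:P\times\mathcal{L}\to\mathcal{L}$ so defined is continuous. The automorphism group $\operatorname{Aut}\Pi$ is the group of all collineations of $\mathrm{PG}(3,\mathbb{R})$, i.e. elements of $\mathrm{PGL}(4,\mathbb{R})$, that map parallel lines to parallel lines; it carries the topology induced from $\mathrm{PGL}(4,\mathbb{R})$. $\mathrm{PSO}(4,\mathbb{R})$ is the image of $\mathrm{SO}(4,\mathbb{R})$ in $\mathrm{PGL}(4,\mathbb{R})$. *)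

(* Defs.v *)
From HB Require Import structures.
From mathcomp Require Import all_boot all_order all_algebra.
From mathcomp Require Import all_classical all_reals all_analysis.

Set Implicit Arguments.
Unset Strict Implicit.
Unset Printing Implicit Defensive.

Import Order.TTheory GRing.Theory Num.Theory.
Import numFieldNormedType.Exports.

Local Open Scope classical_set_scope.
Local Open Scope ring_scope.
Local Open Scope quotient_scope.

Section Grassmannian.
Context (R : realType) (n k : nat).

Definition cols (M : 'M[R]_(n, k)) : seq 'cV[R]_n :=
  [seq col j M | j <- enum 'I_k].

(** The Stiefel manifold of k-frames, with the subspace topology. *)
Definition frame : Type := set_type [set M : 'M[R]_(n, k) | free (cols M)].
HB.instance Definition _ := Topological.on frame.

Definition grass : Type := {U : {vspace 'cV[R]_n} | \dim U == k}.
HB.instance Definition _ := Choice.on grass.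
HB.instance Definition _ := SubType.on grass.

Lemma dim_span_frame (M : frame) : \dim <<cols (val M)>>%VS == k.
Proof.
have /set_mem/= := valP M; rewrite /free => /eqP ->.
by rewrite size_map size_enum_ord.
Qed.

Definition frame_span (M : frame) : grass :=
  exist _ <<cols (val M)>>%VS (dim_span_frame M).

(** The Grassmann topology is the quotient topology of the Stiefel manifold
    under [frame_span]. *)
Definition grass_open (O : set grass) : Prop := open (frame_span @^-1` O).

Lemma grass_openT : grass_open setT.
Proof. by rewrite /grass_open preimage_setT; exact: openT. Qed.

Lemma grass_openI : setI_closed grass_open.
Proof. by move=> A B; exact: openI. Qed.

Lemma grass_open_bigU (I : Type) (f : I -> set grass) :
  (forall i, grass_open (f i)) -> grass_open (\bigcup_i f i).
Proof.
move=> fo; rewrite /grass_open preimage_bigcup.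
by apply: bigcup_open => i _; exact: fo.
Qed.

HB.instance Definition _ :=
  isOpenTopological.Build grass grass_openT grass_openI grass_open_bigU.

End Grassmannian.

Section LinearGroups.
Context (R : realType) (n : nat).

Definition GL : Type := set_type [set A : 'M[R]_n | A \in unitmx].
HB.instance Definition _ := Topological.on GL.

Lemma GL_unit (A : GL) : val A \in unitmx.
Proof. exact: (set_mem (valP A)). Qed.

Definition mkGL (A : 'M[R]_n) (uA : A \in unitmx) : GL :=
  exist _ A (mem_set (uA : [set A : 'M[R]_n | A \in unitmx] A)).

Lemma GL_mul_unit (A B : GL) : val A *m val B \in unitmx.
Proof. by rewrite unitmx_mul !GL_unit. Qed.

Lemma GL_inv_unit (A : GL) : invmx (val A) \in unitmx.
Proof. by rewrite unitmx_inv GL_unit. Qed.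

Definition GL_one : GL := mkGL (unitmx1 R n).
Definition GL_mul (A B : GL) : GL := mkGL (GL_mul_unit A B).
Definition GL_inv (A : GL) : GL := mkGL (GL_inv_unit A).

Definition proj_eq (A B : GL) : bool :=
  `[< exists2 c : R, c != 0 & val A = c *: val B >].

Lemma proj_eq_refl : reflexive proj_eq.
Proof. by move=> A; apply/asboolP; exists 1; rewrite ?oner_neq0 ?scale1r. Qed.

Lemma proj_eq_sym : symmetric proj_eq.
Proof.
have sub A B : proj_eq A B -> proj_eq B A.
  move=> /asboolP[c c0 AB]; apply/asboolP; exists c^-1; rewrite ?invr_eq0//.
  by rewrite AB scalerA mulVf// scale1r.
by move=> A B; apply/idP/idP; exact: sub.
Qed.

Lemma proj_eq_trans : transitive proj_eq.
Proof.
move=> B A C /asboolP[c c0 AB] /asboolP[d d0 BC]; apply/asboolP.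
by exists (c * d); rewrite ?mulf_neq0// AB BC scalerA.
Qed.

Canonical proj_equiv := EquivRel proj_eq proj_eq_refl proj_eq_sym proj_eq_trans.

Definition PGL : Type := quotient_topology {eq_quot proj_eq}.
HB.instance Definition _ := Topological.on PGL.
HB.instance Definition _ := Quotient.on PGL.

Definition PGL_of (A : GL) : PGL := \pi_PGL A.

Lemma PGL_ofP (A B : GL) : PGL_of A = PGL_of B <-> proj_eq A B.
Proof. by split=> [/eqquotP|AB]; last exact/eqquotP. Qed.

Lemma PGL_ofK (g : PGL) : PGL_of (repr g) = g.
Proof. exact: reprK. Qed.

Definition PGL_one : PGL := PGL_of GL_one.
Definition PGL_mul (g h : PGL) : PGL := PGL_of (GL_mul (repr g) (repr h)).
Definition PGL_inv (g : PGL) : PGL := PGL_of (GL_inv (repr g)).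

Lemma repr_PGL_of (A : GL) :
  exists2 c : R, c != 0 & val (repr (PGL_of A)) = c *: val A.
Proof. by apply/asboolP/PGL_ofP; rewrite PGL_ofK. Qed.

Lemma PGL_of_mul (A B : GL) : PGL_mul (PGL_of A) (PGL_of B) = PGL_of (GL_mul A B).
Proof.
have [c c0 cA] := repr_PGL_of A; have [d d0 dB] := repr_PGL_of B.
apply/PGL_ofP/asboolP; exists (c * d); first by rewrite mulf_neq0.
by rewrite /= cA dB -scalemxAl -scalemxAr scalerA.
Qed.

Lemma PGL_of_inv (A : GL) : PGL_inv (PGL_of A) = PGL_of (GL_inv A).
Proof.
have [c c0 cA] := repr_PGL_of A; apply/PGL_ofP/asboolP.
by exists c^-1; rewrite ?invr_eq0//= cA invmxZ// unitmxZ ?unitfE// GL_unit.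
Qed.

Lemma PGL_mulA : associative PGL_mul.
Proof.
move=> f g h; rewrite -(PGL_ofK f) -(PGL_ofK g) -(PGL_ofK h) !PGL_of_mul.
by congr PGL_of; apply/val_inj; exact: mulmxA.
Qed.

Lemma PGL_mul1g : left_id PGL_one PGL_mul.
Proof.
move=> g; rewrite -(PGL_ofK g) PGL_of_mul.
by congr PGL_of; apply/val_inj; exact: mul1mx.
Qed.

Lemma PGL_mulg1 : right_id PGL_one PGL_mul.
Proof.
move=> g; rewrite -(PGL_ofK g) PGL_of_mul.
by congr PGL_of; apply/val_inj; exact: mulmx1.
Qed.

Lemma PGL_mulVg : left_inverse PGL_one PGL_inv PGL_mul.
Proof.
move=> g; rewrite -(PGL_ofK g) PGL_of_inv PGL_of_mul.
by congr PGL_of; apply/val_inj; exact: (mulVmx (GL_unit _)).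
Qed.

Lemma PGL_mulgV : right_inverse PGL_one PGL_inv PGL_mul.
Proof.
move=> g; rewrite -(PGL_ofK g) PGL_of_inv PGL_of_mul.
by congr PGL_of; apply/val_inj; exact: (mulmxV (GL_unit _)).
Qed.

HB.instance Definition _ := isGroup.Build PGL
  PGL_mulA PGL_mul1g PGL_mulg1 PGL_mulVg PGL_mulgV.

Definition SO : set GL := [set A | val A *m (val A)^T = 1%:M /\ \det (val A) = 1].

Definition PSO : set PGL := PGL_of @` SO.

End LinearGroups.

Arguments SO R n : clear implicits.
Arguments PSO R n : clear implicits.

Section Action.
Context (R : realType) (n k : nat).

Lemma dim_mulmx (A : GL R n) (U : grass R n k) :
  \dim (linfun (mulmx (val A)) @: val U)%VS == k.
Proof.
rewrite limg_dim_eq; first exact: (valP U).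
apply/eqP; rewrite -subv0; apply/subvP => v; rewrite memv_cap memv0.
move=> /andP[_]; rewrite memv_ker lfunE/= => /eqP Av0.
by rewrite -(mulKmx (GL_unit A) v) Av0 mulmx0.
Qed.

Definition GL_act (A : GL R n) (U : grass R n k) : grass R n k :=
  exist _ (linfun (mulmx (val A)) @: val U)%VS (dim_mulmx A U).

Definition PGL_act (g : PGL R n) (U : grass R n k) : grass R n k :=
  GL_act (repr g) U.

Lemma PGL_actE (A : GL R n) (U : grass R n k) :
  PGL_act (PGL_of A) U = GL_act A U.
Proof.
have [c c0 cA] := repr_PGL_of A; apply/val_inj/vspaceP => v /=; rewrite cA.
apply/memv_imgP/memv_imgP => -[u uU ->]; rewrite lfunE/=.
  exists (c *: u); first by rewrite memvZ.
  by rewrite lfunE/= -scalemxAl -scalemxAr.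
exists (c^-1 *: u); first by rewrite memvZ.
by rewrite lfunE/= -scalemxAl -scalemxAr scalerA divff// scale1r.
Qed.

Lemma PGL_act1 (U : grass R n k) : PGL_act 1%g U = U.
Proof.
rewrite [LHS]PGL_actE; apply/val_inj => /=.
rewrite -[RHS]lim1g; congr (_ @: _)%VS; apply/lfunP => v.
by rewrite !lfunE/= mul1mx.
Qed.

End Action.

Section Parallelism.
Context (R : realType).

Definition pg_point : Type := grass R 4 1.
HB.instance Definition _ := Topological.on pg_point.

Definition pg_line : Type := grass R 4 2.
HB.instance Definition _ := Topological.on pg_line.

Definition incident (p : pg_point) (L : pg_line) : Prop := (val p <= val L)%VS.

Record parallelism : Type := Parallelism {
  parallel :> pg_line -> pg_line -> Prop;
  parallel_refl : forall L, parallel L L;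
  parallel_sym : forall L M, parallel L M -> parallel M L;
  parallel_trans : forall L M N, parallel L M -> parallel M N -> parallel L N;
  parallel_ex1 : forall (p : pg_point) (L : pg_line),
    exists! K : pg_line, incident p K /\ parallel K L
}.

Definition parallel_through (Pi : parallelism) (p : pg_point) (L : pg_line) : pg_line :=
  sval (cid (parallel_ex1 Pi p L)).

Definition topological_parallelism (Pi : parallelism) : Prop :=
  continuous (fun pL : pg_point * pg_line => parallel_through Pi pL.1 pL.2).

(** Parallel classes are spreads, and collineations map spreads to spreads, so
    a collineation preserving parallelism also reflects it; hence this set is
    closed under inverses although only one implication is required. *)
Definition Aut_par (Pi : parallelism) : set (PGL R 4) :=
  [set g | forall L M : pg_line, Pi L M -> Pi (PGL_act g L) (PGL_act g M)].

Definition Aut_par1 (Pi : parallelism) : set (PGL R 4) :=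
  connected_component (Aut_par Pi) 1%g.

End Parallelism.

(* Main.v *)
(** The group [Aut Pi] is relatively compact in PGL(4). Otherwise Gaussian
    elimination with pivoting gives automorphisms A_t and bases (u_l), (w_l)
    (depending on t and converging to bases) with A_t u_l = d_l w_l and, after
    possibly passing to inverses, d_j / d_i -> 0 and d_k / d_i -> 0 for some
    distinct i, j, k. Let m be the fourth index, L = <u_j, u_k + s u_i>, and let
    M be the parallel to L through u_m. For small s <> 0 the line M is not
    contained in <u_m, u_j, u_k>, so A_t L and A_t M converge to <w_j, w_i> and
    <w_m, w_i>. As parallelism is a closed relation, these are two distinct
    parallel lines that meet: a contradiction.
    The group of representatives of determinant +-1 is then bounded, so it
    preserves a positive definite quadratic form: the minimizer of a strictly
    convex invariant function. *)
Require Import Defs.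
From mathcomp Require Import all_boot all_order all_algebra.
From mathcomp Require Import all_classical all_reals all_analysis.
From mathcomp Require Import perm ring lra.

Set Implicit Arguments.
Unset Strict Implicit.
Unset Printing Implicit Defensive.

Import Order.TTheory GRing.Theory Num.Theory.
Import numFieldNormedType.Exports.

Local Open Scope classical_set_scope.
Local Open Scope ring_scope.

(** * Limits of matrices *)

(** Limits are taken along ultrafilters, so that all bounded data converge at once and no
    subsequences are extracted. The Grassmannian only has a quotient topology; uniqueness of limits
    in it comes from the continuous map that sends a subspace to its orthogonal projector. The two
    cases behind the passage to inverses arise as follows. With determinants of absolute value 1,
    unbounded norms force the first pivot to infinity while the product of the pivots keeps absolute
    value 1, so the ratio of the last pivot to the first tends to 0. If the ratio of the third to
    the first also tends to 0, the first index dominates two others. Otherwise the last pivot is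
    negligible against both the first and the third, which is the same situation for the inverses.
    The bound holds on all of [Aut_par Pi]; restricting to the identity component makes determinants
    positive, which yields PSO rather than PO. *)

Section MatrixLimits.
Context {R : realType} {T : Type} {F : set_system T} {FF : Filter F}.

Lemma cvg_mxP m n (f : T -> 'M[R]_(m, n)) (A : 'M[R]_(m, n)) :
  f t @[t --> F] --> A <-> forall i j, f t i j @[t --> F] --> A i j.
Proof.
split=> [fA i j|fA]; first exact: (cvg_comp _ _ fA (@coord_continuous R m n i j A)).
move=> U [P AP PU].
have : \forall t \near F, forall i j, P i j (f t i j).
  by apply: filter_forall => i; apply: filter_forall => j; exact: fA (AP i j).
by apply: filterS => t; exact: PU.
Qed.

Lemma cvg_sum (I : finType) (f : I -> T -> R) (a : I -> R) :
  (forall i, f i t @[t --> F] --> a i) ->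
  \sum_i f i t @[t --> F] --> \sum_i a i.
Proof.
by move=> fa; apply: cvg_big => //; exact: add_continuous.
Qed.

Lemma cvg_prod (I : finType) (f : I -> T -> R) (a : I -> R) :
  (forall i, f i t @[t --> F] --> a i) ->
  \prod_i f i t @[t --> F] --> \prod_i a i.
Proof.
by move=> fa; apply: cvg_big => //; exact: mul_continuous.
Qed.

Lemma cvg_mulmx m n p (f : T -> 'M[R]_(m, n)) (g : T -> 'M[R]_(n, p))
    (A : 'M[R]_(m, n)) (B : 'M[R]_(n, p)) :
  f t @[t --> F] --> A -> g t @[t --> F] --> B ->
  (f t *m g t) @[t --> F] --> A *m B.
Proof.
move=> /cvg_mxP fA /cvg_mxP gB; apply/cvg_mxP => i j; rewrite mxE.
under eq_fun do rewrite mxE.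
by apply: cvg_sum => k; exact: cvgM.
Qed.

Lemma cvg_trmx m n (f : T -> 'M[R]_(m, n)) (A : 'M[R]_(m, n)) :
  f t @[t --> F] --> A -> (f t)^T @[t --> F] --> A^T.
Proof.
move=> /cvg_mxP fA; apply/cvg_mxP => i j; rewrite mxE.
by under eq_fun do rewrite mxE; exact: fA.
Qed.

Lemma cvg_det n (f : T -> 'M[R]_n) (A : 'M[R]_n) :
  f t @[t --> F] --> A -> \det (f t) @[t --> F] --> \det A.
Proof.
move=> /cvg_mxP fA; apply: cvg_sum => s; apply: cvgM; first exact: cvg_cst.
by apply: cvg_prod => i; exact: fA.
Qed.

(** Cramer's rule: the adjugate is polynomial in the entries. Invertibility of each [f t] resolves
    the case split in the definition of [invmx]. *)
Lemma cvg_invmx n (f : T -> 'M[R]_n) (A : 'M[R]_n) :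
  A \in unitmx -> (forall t, f t \in unitmx) ->
  f t @[t --> F] --> A -> invmx (f t) @[t --> F] --> invmx A.
Proof.
move=> uA uf fA; rewrite /invmx uA; under eq_fun do rewrite uf.
have dA := cvg_det fA; move/cvg_mxP : fA => fA.
apply: cvgZ; first by apply: cvgV; rewrite -?unitfE.
apply/cvg_mxP => i j; rewrite mxE; under eq_fun do rewrite mxE.
apply: cvgM; first exact: cvg_cst.
apply: cvg_det; apply/cvg_mxP => k l; rewrite !mxE.
by under eq_fun do rewrite !mxE; exact: fA.
Qed.

End MatrixLimits.

Lemma ultra_fmap (T U : Type) (f : T -> U) (F : set_system T) :
  UltraFilter F -> UltraFilter (f @ F).
Proof.
move=> FU; split; first exact: fmap_proper_filter.
move=> G GF fFG; apply/seteqP; split=> // A GA.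
have [//|nA] := in_ultra_setVsetC (f @^-1` A) FU.
have GnA : G (~` A) by exact: fFG.
by have /filter_ex[x []] : G (~` A `&` A) by exact: filterI.
Qed.

(** Each entry stays in the compact interval from [-K] to [K], where every ultrafilter converges. *)
Lemma ultra_cvg_mx (R : realType) (T : Type) (F : set_system T) m n (K : R)
    (f : T -> 'M[R]_(m, n)) : UltraFilter F ->
  (forall t i j, `|f t i j| <= K) ->
  exists2 A : 'M[R]_(m, n), f t @[t --> F] --> A & forall i j, `|A i j| <= K.
Proof.
move=> FU fK.
have /choice[a aE] (ij : 'I_m * 'I_n) :
    exists a, f t ij.1 ij.2 @[t --> F] --> a /\ `|a| <= K.
  have := @segment_compact R (- K) K; rewrite compact_ultra.
  move=> /(_ _ (ultra_fmap (fun t => f t ij.1 ij.2) FU)) [].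
    by apply: (@filterE T F) => t /=; rewrite in_itv/= -ler_norml; exact: fK.
  by move=> a [/=]; rewrite in_itv/= -ler_norml => aK fa; exists a.
exists (\matrix_(i, j) a (i, j)) => [|i j]; last by rewrite mxE; case: (aE (i, j)).
by apply/cvg_mxP => i j; rewrite mxE; case: (aE (i, j)).
Qed.

(** * The Grassmannian *)

Section Spans.
Context {R : realType} {n k : nat}.
Implicit Types (M : 'M[R]_(n, k)) (U : grass R n k).

Let colt M : k.-tuple 'cV[R]_n := [tuple col j M | j < k].

Let colt_nth M (j : 'I_k) : (colt M)`_j = col j M.
Proof. by rewrite -tnth_nth tnth_mktuple. Qed.

Lemma mulmx_sum_col M (c : 'cV_k) : M *m c = \sum_j c j 0 *: col j M.
Proof.
apply/matrixP => i j; rewrite ord1 summxE mxE; apply: eq_bigr => l _.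
by rewrite !mxE mulrC.
Qed.

Lemma span_colsP M (v : 'cV[R]_n) :
  reflect (exists c : 'cV_k, v = M *m c) (v \in <<cols M>>%VS).
Proof.
apply: (iffP idP) => [|[c ->]]; last first.
  rewrite mulmx_sum_col; apply: memv_suml => j _.
  by apply/memvZ/memv_span/map_f; exact: mem_enum.
move/(@coord_span _ _ _ (colt M)) => vE; exists (\col_j coord (colt M) j v).
rewrite [LHS]vE mulmx_sum_col.
by apply: eq_bigr => j _; rewrite mxE colt_nth.
Qed.

Lemma free_colsP M :
  reflect (forall c : 'cV_k, M *m c = 0 -> c = 0) (free (cols M)).
Proof.
rewrite (_ : cols M = colt M)//. have fP := @freeP _ _ _ (colt M).
apply: (iffP fP) => fM.
  move=> c; rewrite mulmx_sum_col => c0; apply/matrixP => i j; rewrite ord1 mxE.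
  apply: (fM (fun i => c i 0)); rewrite -[RHS]c0.
  by apply: eq_bigr => l _; rewrite colt_nth.
move=> c c0 i; suff /matrixP/(_ i 0) : \col_j c j = 0 :> 'cV_k by rewrite !mxE.
apply: fM; rewrite mulmx_sum_col -[RHS]c0.
by apply: eq_bigr => l _; rewrite mxE colt_nth.
Qed.

Lemma free_cols_dim M : free (cols M) = (\dim <<cols M>> == k)%N.
Proof. by rewrite /free size_map size_enum_ord. Qed.

(** A vector killed by the Gram matrix has an image under [M] whose sum of squares vanishes, so over
    the reals that image is 0. *)
Lemma free_cols_gram M : free (cols M) -> M^T *m M \in unitmx.
Proof.
move=> /free_colsP fM; rewrite -unitmx_tr -row_free_unit -kermx_eq0.
apply/eqP/row_matrixP => i; rewrite row0; set c := row i _.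
have : c *m (M^T *m M)^T = 0 by rewrite -row_mul mulmx_ker row0.
rewrite trmx_mul trmxK => c0.
suff Mc : M *m c^T = 0 by apply/trmx_inj; rewrite trmx0; exact: fM.
have : (M *m c^T)^T *m (M *m c^T) = 0.
  by rewrite trmx_mul trmxK !mulmxA -(mulmxA c) c0 mul0mx.
move/matrixP => /(_ 0 0); rewrite !mxE => /eqP.
rewrite psumr_eq0 => [/allP s0|j _]; last by rewrite mxE -expr2 sqr_ge0.
apply/matrixP => j l; rewrite ord1 [RHS]mxE; apply/eqP.
by have := s0 j (mem_index_enum j); rewrite mxE mulf_eq0 orbb.
Qed.

Lemma mem_grass_frame U : exists2 M : 'M[R]_(n, k), free (cols M) & val U =
  <<cols M>>%VS.
Proof.
case: U => W /= /eqP dW.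
pose M : 'M[R]_(n, k) := \matrix_(i, j) (vbasis W)`_j i 0.
have cM : cols M = vbasis W.
  apply: (@eq_from_nth _ 0); first by rewrite size_map size_enum_ord size_tuple dW.
  move=> i; rewrite size_map size_enum_ord => ik.
  rewrite (nth_map (Ordinal ik)) ?size_enum_ord//.
  rewrite -[X in nth _ _ X]/(val (Ordinal ik)) nth_ord_enum.
  by apply/matrixP => a b; rewrite !mxE ord1.
exists M; rewrite cM; first exact: basis_free (vbasisP _).
exact/esym/span_basis/vbasisP.
Qed.

Definition mkgrass M (fM : free (cols M)) : grass R n k :=
  @exist {vspace 'cV[R]_n} (fun V => \dim V == k) <<cols M>>%VS
    (etrans (esym (free_cols_dim M)) fM).

(** The orthogonal projector onto the column span of a free [M]: an invariant of the span that is
    explicitly continuous in the frame. *)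
Definition frame_proj M : 'M[R]_n := M *m invmx (M^T *m M) *m M^T.

Lemma frame_projP M (v : 'cV_n) :
  free (cols M) -> (frame_proj M *m v == v) = (v \in <<cols M>>%VS).
Proof.
move=> fM; apply/eqP/span_colsP => [<-|[c ->]].
  by exists (invmx (M^T *m M) *m (M^T *m v)); rewrite /frame_proj !mulmxA.
by rewrite /frame_proj -!mulmxA (mulmxA M^T) mulKmx// free_cols_gram.
Qed.

Lemma frame_proj_mem M (v : 'cV_n) : frame_proj M *m v \in <<cols M>>%VS.
Proof.
by apply/span_colsP; exists (invmx (M^T *m M) *m (M^T *m v));
  rewrite /frame_proj !mulmxA.
Qed.

(** Projectors P, Q with the same image satisfy QP = P and PQ = Q; both are symmetric, so
    transposing the first gives PQ = P. *)
Lemma frame_proj_span M N : free (cols M) -> free (cols N) ->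
  <<cols M>>%VS = <<cols N>>%VS -> frame_proj M = frame_proj N.
Proof.
move=> fM fN MN.
have sym (A : 'M[R]_(n, k)) : (frame_proj A)^T = frame_proj A.
  by rewrite /frame_proj !trmx_mul trmx_inv trmx_mul !trmxK mulmxA.
have id (A B : 'M[R]_(n, k)) : free (cols A) -> <<cols A>>%VS = <<cols B>>%VS ->
    frame_proj A *m frame_proj B = frame_proj B.
  move=> fA AB.
  have colE' j : col j (frame_proj A *m frame_proj B) = col j (frame_proj B).
    rewrite [LHS]colE -mulmxA -colE; apply/eqP.
    by rewrite frame_projP// AB colE frame_proj_mem.
  by apply/matrixP => i j; have /matrixP/(_ i 0) := colE' j; rewrite mxE [RHS]mxE.
by rewrite -[LHS]sym -(id N M)// trmx_mul !sym id.
Qed.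

End Spans.

Lemma cvg_frame_proj (R : realType) (T : Type) (F : set_system T) n k
    (f : T -> 'M[R]_(n, k)) (M : 'M[R]_(n, k)) : Filter F ->
  free (cols M) -> (forall t, free (cols (f t))) ->
  f t @[t --> F] --> M -> frame_proj (f t) @[t --> F] --> frame_proj M.
Proof.
move=> FF fM ff cM; have cMT := cvg_trmx (FF := FF) cM.
have uf t := free_cols_gram (ff t).
have gM := cvg_invmx (FF := FF) (free_cols_gram fM) uf
  (cvg_mulmx (FF := FF) cMT cM).
exact (cvg_mulmx (FF := FF) (cvg_mulmx (FF := FF) cM gM) cMT).
Qed.

Section GrassTopology.
Context {R : realType} {n k : nat}.
Implicit Types U : grass R n k.

Definition grass_proj U : 'M[R]_n := frame_proj (projT1 (cid2 (mem_grass_frame U))).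

Lemma grass_projE U (M : 'M[R]_(n, k)) :
  val U = <<cols M>>%VS -> grass_proj U = frame_proj M.
Proof.
rewrite /grass_proj; case: cid2 => /= N fN -> NM.
by apply: frame_proj_span; rewrite // free_cols_dim -NM -free_cols_dim.
Qed.

Lemma grass_projP U (v : 'cV_n) : (grass_proj U *m v == v) = (v \in val U).
Proof. by have [M fM UM] := mem_grass_frame U;
  rewrite (grass_projE UM) UM frame_projP. Qed.

Lemma grass_proj_mem U (v : 'cV_n) : grass_proj U *m v \in val U.
Proof. by have [M fM UM] := mem_grass_frame U;
  rewrite (grass_projE UM) UM frame_proj_mem. Qed.

Lemma grass_proj_continuous : continuous grass_proj.
Proof.
apply/continuousP => O oO; rewrite /open/= /grass_open.
rewrite (_ : _ @^-1` _ = (frame_proj \o val : frame R n k -> 'M[R]_n) @^-1` O);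
  last first.
  by apply/seteqP; split => M /=; rewrite (@grass_projE _ (val M)).
move: O oO; apply/continuousP => /= M.
have vM : val N @[N --> M] --> (val M : 'M[R]_(n, k)) by exact: initial_continuous.
have fr (N : frame R n k) : free (cols (val N)) by exact: set_mem (valP N).
exact: (cvg_frame_proj _ (fr M) fr vM).
Qed.

Section Limits.
Context {T : Type} {F : set_system T} {FF : ProperFilter F}.

(** The quotient map from frames is continuous. Freeness of [f t] and [M] is not a separate
    hypothesis: spanning a subspace of dimension [k] forces it, and for [M] this excludes
    degeneration in the limit. *)
Lemma cvg_grass (f : T -> 'M[R]_(n, k)) (M : 'M[R]_(n, k)) (g : T -> grass R n
  k) U :
  f t @[t --> F] --> M -> (forall t, val (g t) = <<cols (f t)>>%VS) ->
  val U = <<cols M>>%VS -> g t @[t --> F] --> U.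
Proof.
move=> fM gf UM O; rewrite nbhsE => -[V [oV VU] VO].
have fr N (W : grass R n k) : val W = <<cols N>>%VS -> [set N : 'M[R]_(n, k) |
  free (cols N)] N.
  by move=> WN; rewrite /= free_cols_dim -WN (valP W).
have spanE N W (WN : val W = <<cols N>>%VS) : frame_span (exist _ N (mem_set
  (fr N W WN))) = W.
  by apply/val_inj; rewrite WN.
move: oV; rewrite /open/= /grass_open => -[V' oV' V'V].
have inV N W (WN : val W = <<cols N>>%VS) : V W <-> V' N.
  pose fN : frame R n k := exist _ N (mem_set (fr N W WN)).
  have VN : V' N = V (frame_span fN).
    have := congr1 (fun A : set (frame R n k) => A fN) V'V.
    by rewrite /preimage/= set_valE.
  by rewrite VN spanE.
suff : \forall t \near F, V' (f t) by apply: filterS => t;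
  rewrite -(inV _ _ (gf t)) => /VO.
by apply: fM; apply: open_nbhs_nbhs; split=> //; apply/(inV _ _ UM).
Qed.

Lemma cvg_grass_unique (g : T -> grass R n k) U V :
  g t @[t --> F] --> U -> g t @[t --> F] --> V -> U = V.
Proof.
have gP W : g t @[t --> F] --> W -> grass_proj (g t) @[t --> F] --> grass_proj W.
  by move=> gW; exact: (cvg_comp _ _ gW (@grass_proj_continuous W)).
move=> /gP gU /gP gV; apply/val_inj/vspaceP => v.
by rewrite -!grass_projP (cvg_unique _ gU gV).
Qed.

End Limits.
End GrassTopology.

(** * Lines and parallelisms *)

Section PlanesAndLines.
Context {R : realType} {n : nat}.
Implicit Types (x y v : 'cV[R]_n).

Definition two x y : 'M[R]_(n, 2) := row_mx x y.

Lemma two_mulmx x y (c : 'cV[R]_2) : two x y *m c = c 0 0 *: x + c 1 0 *: y.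
Proof.
rewrite mulmx_sum_col big_ord_recl big_ord1.
have l1 : lift ord0 ord0 = 1 :> 'I_2 by exact/val_inj.
have -> : col ord0 (two x y) = x.
  rewrite (_ : ord0 = @lshift 1 1 ord0 :> 'I_2); last exact/val_inj.
  by apply/matrixP => i j; rewrite mxE (row_mxEl x y) [j]ord1.
have -> : col (lift ord0 ord0) (two x y) = y.
  rewrite (_ : lift ord0 ord0 = @rshift 1 1 ord0 :> 'I_2); last exact/val_inj.
  by apply/matrixP => i j; rewrite mxE (row_mxEr x y) [j]ord1.
by rewrite l1.
Qed.

Lemma two_spanP x y v :
  reflect (exists ab : R * R, v = ab.1 *: x + ab.2 *: y) (v \in <<cols (two x
    y)>>%VS).
Proof.
apply: (iffP (span_colsP _ _)) => [[c ->]|[[a b] ->]].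
  by exists (c 0 0, c 1 0); rewrite two_mulmx.
exists (\col_i if i == 0 then a else b); rewrite two_mulmx !mxE//.
Qed.

Lemma two_freeP x y : (forall a b, a *: x + b *: y = 0 -> a = 0 /\ b = 0) ->
  free (cols (two x y)).
Proof.
move=> xy; apply/free_colsP => c; rewrite two_mulmx => /xy[c0 c1].
apply/matrixP => i j; rewrite ord1 [RHS]mxE.
by case: i => -[|[|//]] i2; [rewrite -[RHS]c0|rewrite -[RHS]c1];
  congr (fun_of_matrix _ _ _); exact/val_inj.
Qed.

Lemma span_two x y (L : grass R n 2) : free (cols (two x y)) ->
  x \in val L -> y \in val L -> val L = <<cols (two x y)>>%VS.
Proof.
move=> fxy xL yL; apply/esym/eqP; rewrite eqEdim.
move: fxy; rewrite free_cols_dim => /eqP ->; rewrite (eqP (valP L)) leqnn andbT.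
by apply/subvP => v /two_spanP[[a b] ->]; rewrite memvD ?memvZ.
Qed.

Lemma span_twoZ x y (a b : R) : a != 0 -> b != 0 ->
  <<cols (two (a *: x) (b *: y))>>%VS = <<cols (two x y)>>%VS.
Proof.
move=> a0 b0; apply/vspaceP => v; apply/two_spanP/two_spanP => -[[c d] ->]/=.
  by exists (c * a, d * b); rewrite /= !scalerA.
by exists (c / a, d / b); rewrite /= !scalerA !divfK.
Qed.

Lemma cvg_two (T : Type) (F : set_system T) (FF : Filter F) (f g : T ->
  'cV[R]_n) x y :
  f t @[t --> F] --> x -> g t @[t --> F] --> y ->
  two (f t) (g t) @[t --> F] --> two x y.
Proof.
move=> /cvg_mxP fx /cvg_mxP gy; apply/(cvg_mxP (n := 1 + 1)) => i j; rewrite mxE.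
under eq_fun do rewrite mxE.
by case: (fintype.split j) => l; [exact: fx|exact: gy].
Qed.

Lemma span_cV x : <<cols x>>%VS = <[x]>%VS.
Proof.
apply/vspaceP => v; apply/span_colsP/vlineP => -[c ->].
  exists (c 0 0); rewrite mulmx_sum_col big_ord1; congr (_ *: _).
  by apply/matrixP => i j; rewrite mxE [j]ord1 ?[ord0]ord1.
exists c%:M; rewrite mulmx_sum_col big_ord1 mxE mulr1n; congr (_ *: _).
by apply/matrixP => i j; rewrite mxE [j]ord1 ?[ord0]ord1.
Qed.

Lemma pt_subproof x : x != 0 -> \dim <[x]>%VS == 1%N.
Proof. by rewrite dim_vline => ->. Qed.

Definition pt x (x0 : x != 0) : grass R n 1 := exist _ <[x]>%VS (pt_subproof x0).

Lemma cvg_pt (T : Type) (F : set_system T) (FF : ProperFilter F) (f : T ->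
  'cV[R]_n) x
    (f0 : forall t, f t != 0) (x0 : x != 0) :
  f t @[t --> F] --> x -> pt (f0 t) @[t --> F] --> pt x0.
Proof. by move=> fx; apply: (cvg_grass fx) => [t|]; rewrite span_cV. Qed.

Lemma GL_actP k (A : GL R n) (U : grass R n k) v :
  reflect (exists2 u, u \in val U & v = val A *m u) (v \in val (GL_act A U)).
Proof.
by apply: (iffP memv_imgP) => -[u uU ->]; exists u; rewrite ?lfunE.
Qed.

Lemma GL_act_mem k (A : GL R n) (U : grass R n k) x :
  x \in val U -> val A *m x \in val (GL_act A U).
Proof. by move=> xU; apply/GL_actP; exists x. Qed.

Lemma GL_act_cols k (A : GL R n) (U : grass R n k) (M : 'M[R]_(n, k)) :
  val U = <<cols M>>%VS -> val (GL_act A U) = <<cols (val A *m M)>>%VS.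
Proof.
move=> UM; apply/vspaceP => v; apply/GL_actP/span_colsP => [[u]|[c ->]].
  by rewrite UM => /span_colsP[c ->] ->; exists c; rewrite mulmxA.
by exists (M *m c); rewrite ?mulmxA// UM; apply/span_colsP; exists c.
Qed.

Lemma GL_act_two (A : GL R n) (L : grass R n 2) x y : val L = <<cols (two x
  y)>>%VS ->
  val (GL_act A L) = <<cols (two (val A *m x) (val A *m y))>>%VS.
Proof. by move=> /GL_act_cols->; rewrite /two -mul_mx_row. Qed.

End PlanesAndLines.

Section ParallelismTheory.
Context {R : realType} (Pi : parallelism R).
Implicit Types (L M K : pg_line R) (A : GL R 4).

Lemma parallel_throughP (p : pg_point R) L :
  incident p (parallel_through Pi p L) /\ Pi (parallel_through Pi p L) L.
Proof. by rewrite /parallel_through; case: cid => /= K [+ _]. Qed.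

Lemma parallel_through_unique (p : pg_point R) L K :
  incident p K -> Pi K L -> parallel_through Pi p L = K.
Proof.
by rewrite /parallel_through; case: cid => /= N [_ NU] pK KL; exact: NU.
Qed.

Lemma incident_pt (x : 'cV[R]_4) (x0 : x != 0) L : incident (pt x0) L <-> x \in
  val L.
Proof. by rewrite /incident memvE. Qed.

Lemma parallel_meet_eq (x : 'cV[R]_4) L M :
  Pi L M -> x != 0 -> x \in val L -> x \in val M -> L = M.
Proof.
move=> LM x0 xL xM.
rewrite -(@parallel_through_unique (pt x0) M L) ?incident_pt//.
by rewrite (@parallel_through_unique (pt x0) M M) ?incident_pt//;
  exact: parallel_refl.
Qed.

Definition aut_GL A := forall L M, Pi L M -> Pi (GL_act A L) (GL_act A M).

Lemma aut_GLP A : aut_GL A <-> Aut_par Pi (PGL_of A).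
Proof. by split=> h L M /h; rewrite !PGL_actE. Qed.

Lemma GL_act_mul (A B : GL R 4) L : GL_act (GL_mul A B) L = GL_act A (GL_act B L).
Proof.
apply/val_inj/vspaceP => v; apply/GL_actP/GL_actP => -[u uL ->].
  by exists (val B *m u); rewrite ?GL_act_mem// mulmxA.
by move: uL => /GL_actP[w wL ->]; exists w; rewrite // mulmxA.
Qed.

Lemma GL_act1 L : GL_act (GL_one R 4) L = L.
Proof. by rewrite -PGL_actE PGL_act1. Qed.

Lemma aut_GL_mul A B : aut_GL A -> aut_GL B -> aut_GL (GL_mul A B).
Proof. by move=> aA aB L M /aB/aA; rewrite !GL_act_mul. Qed.

Lemma GL_mulVg A : GL_mul (GL_inv A) A = GL_one R 4.
Proof. by apply/val_inj; exact: (mulVmx (Defs.GL_unit _)). Qed.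

Lemma line_neq0 L : exists2 x : 'cV[R]_4, x != 0 & x \in val L.
Proof.
exists (vpick (val L)); last exact: memv_pick.
by rewrite vpick0 -dimv_eq0 (eqP (valP L)).
Qed.

(* Both the image of the parallel class of L and the parallel class of its
   image are spreads, and the first is contained in the second. *)
Lemma aut_GL_inv A : aut_GL A -> aut_GL (GL_inv A).
Proof.
move=> aA L M LM; have [x x0 xL] := line_neq0 L.
have uA := Defs.GL_unit A.
set K := GL_act (GL_inv A) M.
have Ax0 : val (GL_inv A) *m x != 0.
  by apply: contraNneq x0 => /(congr1 (mulmx (val A)));
    rewrite mulmx0 mulKVmx// => ->.
have [pN NK] := parallel_throughP (pt Ax0) K;
  set N := parallel_through _ _ _ in pN NK.
have AK : GL_act A K = M.
  rewrite /K -GL_act_mul -[RHS]GL_act1; congr GL_act.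
  by apply/val_inj; exact: (mulmxV (Defs.GL_unit _)).
have AN : GL_act A N = L.
  apply: (@parallel_meet_eq x) => //.
    by apply: parallel_trans (aA _ _ NK) _; rewrite AK; exact: parallel_sym.
  have := GL_act_mem A ((incident_pt Ax0 N).1 pN).
  by rewrite mulmxA mulmxV// mul1mx.
by rewrite -AN -GL_act_mul GL_mulVg GL_act1.
Qed.

Hypothesis Pi_top : topological_parallelism Pi.

Lemma cvg_parallel_through (T : Type) (F : set_system T) (FF : ProperFilter F)
    (p : T -> pg_point R) (L : T -> pg_line R) p0 L0 :
  p t @[t --> F] --> p0 -> L t @[t --> F] --> L0 ->
  parallel_through Pi (p t) (L t) @[t --> F] --> parallel_through Pi p0 L0.
Proof.
move=> pp0 LL0.
exact: (cvg_comp _ _ (cvg_pair pp0 LL0) (@Pi_top (p0, L0))).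
Qed.

(** Each [L t] is the parallel to [M t] through the point [x t], so by continuity it tends to the
    parallel to [M0] through [x0]; uniqueness of limits identifies that line with [L0]. *)
Lemma parallel_cvg (T : Type) (F : set_system T) (FF : ProperFilter F)
    (L M : T -> pg_line R) L0 M0 (x : T -> 'cV[R]_4) (x0 : 'cV[R]_4) :
  L t @[t --> F] --> L0 -> M t @[t --> F] --> M0 -> x t @[t --> F] --> x0 ->
  (forall t, Pi (L t) (M t)) -> (forall t, x t \in val (L t)) ->
  (forall t, x t != 0) -> x0 != 0 -> Pi L0 M0.
Proof.
move=> LL0 MM0 xx0 LM xL xn0 x0n0.
have := cvg_parallel_through FF (cvg_pt FF xn0 (x0 := x0n0) xx0) MM0.
rewrite (_ : (fun t => _) = L); last first.
  by apply/funext => t; apply: parallel_through_unique; rewrite ?incident_pt.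
move=> /(cvg_grass_unique LL0) ->.
by have [] := parallel_throughP (pt x0n0) M0.
Qed.

End ParallelismTheory.

(** * Dynamics of unbounded sequences of automorphisms *)

Lemma cvgR_unique (R : realType) (T : Type) (F : set_system T) (f : T -> R) (a
  b : R) :
  ProperFilter F -> f t @[t --> F] --> a -> f t @[t --> F] --> b -> a = b.
Proof. by move=> FF; apply: (@cvg_unique R (@Rhausdorff R)). Qed.

Section Dynamics.
Context {R : realType} (Pi : parallelism R) (Pi_top : topological_parallelism Pi).

Local Notation e := (fun i : 'I_4 => delta_mx i 0%R : 'cV[R]_4).

Lemma unit_mulmx_eq0 n (U : 'M[R]_n) (c : 'cV[R]_n) :
  U \in unitmx -> U *m c = 0 -> c = 0.
Proof. by move=> uU Uc0; rewrite -(mulKmx uU c) Uc0 mulmx0. Qed.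

Lemma line_other (L : grass R 4 2) (x : 'cV[R]_4) :
  exists2 y, y \in val L & y \notin <[x]>%VS.
Proof.
have /subvPn[y yL yx] : ~~ (val L <= <[x]>)%VS; last by exists y.
apply/negP => /dimvS; rewrite (eqP (valP L)) dim_vline.
by case: (x != 0).
Qed.

Lemma unit_e_neq0 (U : 'M[R]_4) i : U \in unitmx -> U *m e i != 0.
Proof.
move=> uU; apply/eqP => /(unit_mulmx_eq0 uU)/matrixP/(_ i 0)/eqP.
by rewrite !mxE !eqxx oner_eq0.
Qed.

(** The second generator is bounded, of norm exactly 1 and without [m]-coordinate, so that any limit
    of such generators is still independent of [e m]. *)
Lemma line_normal_form (U : 'M[R]_4) (L : grass R 4 2) m :
  U \in unitmx -> U *m e m \in val L ->
  exists c : 'cV[R]_4, [/\ c m 0 = 0, `|c| = 1 &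
    val L = <<cols (two (U *m e m) (U *m c))>>%VS].
Proof.
move=> uU emL; have [y yL ym] := line_other L (U *m e m).
pose d := invmx U *m y; pose c := d - d m 0 *: e m.
have UdE : U *m d = y by rewrite /d mulKVmx.
have cm : c m 0 = 0 by rewrite !mxE !eqxx mulr1 subrr.
have c0 : c != 0.
  apply: contra ym; rewrite subr_eq0 => /eqP dE; apply/vlineP; exists (d m 0).
  by rewrite -UdE {1}dE -scalemxAr.
have nc0 : `|c| != 0 by rewrite normr_eq0.
exists (`|c|^-1 *: c); split.
- by rewrite mxE cm mulr0.
- by rewrite normrZ normfV normr_id mulVf.
rewrite -scalemxAr -[X in two X _]scale1r span_twoZ ?oner_eq0 ?invr_eq0//.
apply: span_two => //; last first.
  by rewrite mulmxBr UdE -scalemxAr memvB// memvZ.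
apply: two_freeP => a b; rewrite !scalemxAr -mulmxDr => /(unit_mulmx_eq0 uU) ab.
have b0 : b = 0.
  apply/eqP; move: c0; apply: contraNT => b0; apply/eqP/matrixP => i j.
  rewrite ord1 [RHS]mxE; case: (eqVneq i m) => [->//|im].
  move/matrixP : ab => /(_ i 0); rewrite !mxE (negPf im) mulr0 add0r => /eqP.
  by rewrite mulf_eq0 (negPf b0)/= => /eqP.
split=> //; move/matrixP : ab => /(_ m 0).
by rewrite b0 scale0r addr0 !mxE !eqxx mulr1.
Qed.

Lemma ord4_uniqP (i m j k : 'I_4) : uniq [:: i; m; j; k] ->
  forall l, [\/ l = i, l = m, l = j | l = k].
Proof.
move=> us l; have : l \in [:: i; m; j; k].
  have sub : {subset [:: i; m; j; k] <= enum 'I_4} by move=> x; rewrite mem_enum.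
  have [|_ ->] := uniq_min_size us sub; first by rewrite size_enum_ord.
  by rewrite mem_enum.
by rewrite !inE => /or4P[]/eqP ->; [constructor 1|constructor 2|constructor
  3|constructor 4].
Qed.

(* The parallel to L = <u_j, u_k> through u_m leaves the plane <u_m, u_j, u_k>,
   since two parallels in a plane would meet; so do the parallels to nearby
   lines. *)
Lemma parallel_leaves_plane (U : 'M[R]_4) (i m j k : 'I_4)
    (uU : U \in unitmx) (us : uniq [:: i; m; j; k])
    (L : R -> pg_line R) :
  (forall s, val (L s) = <<cols (two (U *m e j) (U *m (e k + s *: e i)))>>%VS) ->
  exists2 s, s != 0 & exists2 c, U *m c \in val
    (parallel_through Pi (pt (unit_e_neq0 m uU)) (L s)) & c i 0 != 0.
Proof.
move: (us); rewrite /= !inE !negb_or => /and4P[/and3P[im ij ik] /andP[mj mk] jk _].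
move=> LE; apply: contrapT => H.
pose M s := parallel_through Pi (pt (unit_e_neq0 m uU)) (L s).
have HM s v : s != 0 -> v \in val (M s) -> (invmx U *m v) i 0 = 0.
  move=> s0 vM; apply/eqP/negPn/negP => vi; apply: H; exists s => //.
  by exists (invmx U *m v); rewrite // mulKVmx.
have LL : L s @[s --> 0^'] --> L 0.
  suff cL : two (U *m e j) (U *m (e k + s *: e i)) @[s --> 0^'] -->
      two (U *m e j) (U *m (e k + (0 : R) *: e i)).
    exact: cvg_grass cL LE (LE 0).
  apply: cvg_two; first exact: cvg_cst.
  apply: cvg_mulmx; first exact: cvg_cst.
  apply: cvgD; first exact: cvg_cst.
  by apply: cvgZr_tmp; exact: nbhs_dnbhs.
have MM : M s @[s --> 0^'] --> M 0.
  by apply: cvg_parallel_through => //; exact: cvg_cst.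
(* A vector of [M 0] is the limit of its projections to [M s], so the vanishing of the [i]-th
   coordinate passes to s = 0. *)
have HM0 v : v \in val (M 0) -> (invmx U *m v) i 0 = 0.
  rewrite -grass_projP => /eqP vE.
  have gM : grass_proj (M s) @[s --> 0^'] --> grass_proj (M 0).
    exact: (cvg_comp _ _ MM (@grass_proj_continuous _ _ _ (M 0))).
  have : invmx U *m (grass_proj (M s) *m v) @[s --> 0^'] -->
      invmx U *m (grass_proj (M 0) *m v).
    apply: cvg_mulmx; first exact: cvg_cst.
    by apply: cvg_mulmx => //; exact: cvg_cst.
  move=> /cvg_mxP/(_ i 0); rewrite vE => vlim.
  apply: (cvgR_unique _ vlim).
  apply: cvg_near_cst; near=> s.
  apply: (HM s); last exact: grass_proj_mem.
  by near: s; exact: nbhs_dnbhs_neq.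
have [emM ML] := parallel_throughP Pi (pt (unit_e_neq0 m uU)) (L 0).
move: emM => /incident_pt emM; rewrite -/(M 0) in emM ML.
have [c [cm c1 ME]] := line_normal_form uU emM.
have UcM : U *m c \in val (M 0).
  by rewrite ME; apply/two_spanP; exists (0, 1); rewrite /= scale0r add0r scale1r.
have ci : c i 0 = 0 by have := HM0 _ UcM; rewrite mulKmx.
have c0 : c != 0 by rewrite -normr_eq0 c1 oner_eq0.
have cE : c = c j 0 *: e j + c k 0 *: e k.
  apply/matrixP => l z; rewrite ord1 !mxE.
  have [->|->|->|->] := ord4_uniqP us l; rewrite ?eqxx ?(negPf ij) ?(negPf ik)
    ?(negPf mj) ?(negPf mk) ?(negPf jk) 1?eq_sym ?(negPf jk) !(mulr0, mulr1,
      addr0, add0r)//.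
have UcL : U *m c \in val (L 0).
  suff : U *m c \in <<cols (two (U *m e j) (U *m (e k + (0 : R) *: e i)))>>%VS.
    by rewrite -(LE 0).
  apply/two_spanP; exists (c j 0, c k 0).
  by rewrite scale0r addr0 {1}cE mulmxDr !scalemxAr.
(* Without [i]- and [m]-coordinates, [c] gives a common point of two parallels. They coincide,
   although [U *m e m] is not on [L 0]. *)
have ML0 : M 0 = L 0.
  apply: (parallel_meet_eq ML _ UcM UcL).
  by apply: contra_neq c0 => /(unit_mulmx_eq0 uU).
have LE0 v : v \in val (L 0) ->
    v \in <<cols (two (U *m e j) (U *m (e k + (0 : R) *: e i)))>>%VS.
  by rewrite -(LE 0).
move: emM; rewrite ML0 => /LE0/two_spanP[[a b]] /=.
rewrite scale0r addr0 !scalemxAr -mulmxDr => /(congr1 (mulmx (invmx U))).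
rewrite !mulKmx// => /matrixP/(_ m 0); rewrite !mxE eqxx (negPf mj) (negPf mk).
by rewrite !mulr0 addr0 => /eqP; rewrite oner_eq0.
Unshelve. all: by end_near. Qed.

Lemma free_two_unit (U : 'M[R]_4) (c c' : 'cV[R]_4) : U \in unitmx ->
  (forall a b, a *: c + b *: c' = 0 -> a = 0 /\ b = 0) ->
  free (cols (two (U *m c) (U *m c'))).
Proof.
move=> uU cc; apply: two_freeP => a b; rewrite !scalemxAr -mulmxDr.
by move=> /(unit_mulmx_eq0 uU)/cc.
Qed.

Lemma e_free (i j k : 'I_4) (a b s : R) : j != k -> j != i -> k != i ->
  a *: e j + b *: (e k + s *: e i) = 0 -> a = 0 /\ b = 0.
Proof.
move=> jk ji ki /matrixP E; have := E j 0; have := E k 0; rewrite !mxE !eqxx.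
rewrite (negPf jk) (negPf ji) (negPf ki) eq_sym (negPf jk).
by rewrite !(mulr0, mulr1, addr0, add0r).
Qed.

(* If A_t stretches u_i much more than u_j and u_k, then A_t maps the parallel
   lines L = <u_j, u_k + s u_i> and M = Pi(u_m, L) to lines that converge to
   <w_j, w_i> and <w_m, w_i>: two distinct parallels that meet. *)
Lemma aut_no_contraction (T : Type) (F : set_system T) (UF : UltraFilter F)
    (A : T -> GL R 4) (U W : T -> 'M[R]_4) (U0 W0 : 'M[R]_4)
    (d : T -> 'rV[R]_4) (i m j k : 'I_4) :
  (forall t, aut_GL Pi (A t)) ->
  (forall t, U t \in unitmx) -> U0 \in unitmx -> U t @[t --> F] --> U0 ->
  (forall t, W t \in unitmx) -> W0 \in unitmx -> W t @[t --> F] --> W0 ->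
  (forall t, val (A t) *m U t = W t *m diag_mx (d t)) ->
  (forall t l, d t 0 l != 0) -> uniq [:: i; m; j; k] ->
  d t 0 j / d t 0 i @[t --> F] --> 0 ->
  d t 0 k / d t 0 i @[t --> F] --> 0 -> False.
Proof.
move=> aA uU uU0 UU0 uW uW0 WW0 AUW d0 us dj dk.
move: (us); rewrite /= !inE !negb_or => /and4P[/and3P[im ij ik] /andP[mj mk] jk _].
have ji : j != i by rewrite eq_sym.
have ki : k != i by rewrite eq_sym.
have fL (V : 'M[R]_4) (uV : V \in unitmx) s :
    free (cols (two (V *m e j) (V *m (e k + s *: e i)))).
  by apply: free_two_unit => // a b; exact: e_free.
pose L (V : 'M[R]_4) uV s : pg_line R := mkgrass (fL V uV s).
have [s s0 [c cM ci]] := @parallel_leaves_plane U0 i m j k uU0 us (L U0 uU0)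
  (fun=> erefl).
set M0 := parallel_through _ _ _ in cM.
pose M t := parallel_through Pi (pt (unit_e_neq0 m (uU t))) (L (U t) (uU t) s).
have LL0 : L (U t) (uU t) s @[t --> F] --> L U0 uU0 s.
  suff cL : two (U t *m e j) (U t *m (e k + s *: e i)) @[t --> F] -->
      two (U0 *m e j) (U0 *m (e k + s *: e i)) by exact: (cvg_grass cL).
  by apply: cvg_two; apply: cvg_mulmx => //; exact: cvg_cst.
have MM0 : M t @[t --> F] --> M0.
  apply: cvg_parallel_through => //; apply: cvg_pt.
  by apply: cvg_mulmx => //; exact: cvg_cst.
have MP t : incident (pt (unit_e_neq0 m (uU t))) (M t) /\ Pi (M t) (L (U t) (uU
  t) s).
  exact: parallel_throughP.
have /choice[b bP] t : exists b : 'cV[R]_4, [/\ b m 0 = 0, `|b| = 1 &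
    val (M t) = <<cols (two (U t *m e m) (U t *m b))>>%VS].
  by apply: line_normal_form => //; apply/(@incident_pt _ _ (unit_e_neq0 m (uU
    t)))/(MP t).1.
have [b0 bb0 _] : exists2 b0 : 'cV[R]_4, b t @[t --> F] --> b0 & forall i j,
  `|b0 i j| <= 1.
  apply: ultra_cvg_mx => t l z; have [_ <- _] := bP t.
  rewrite [leRHS]/Num.Def.normr/= mx_normrE; exact: (le_bigmax _ _ (l, z)).
have b0m : b0 m 0 = 0.
  have /cvg_mxP/(_ m 0) := bb0; rewrite (_ : (fun t => _) = cst 0); last first.
    by apply/funext => t; have [] := bP t.
  by move=> h; apply: (cvgR_unique _ h); exact: cvg_cst.
have b01 : `|b0| = 1.
  have : `|b t| @[t --> F] --> `|b0| by exact: cvg_norm.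
  rewrite (_ : (fun t => _) = cst 1); last first.
    by apply/funext => t; have [] := bP t.
  by move=> h; apply: (cvgR_unique _ h); exact: cvg_cst.
have b0n0 : b0 != 0 by rewrite -normr_eq0 b01 oner_eq0.
have fM : free (cols (two (U0 *m e m) (U0 *m b0))).
  apply: free_two_unit => // x y xy.
  have y0 : y = 0.
    apply/eqP; move: b0n0; apply: contraNT => y0; apply/eqP/matrixP => l z.
    rewrite ord1 [RHS]mxE; case: (eqVneq l m) => [->//|lm].
    move/matrixP : xy => /(_ l 0); rewrite !mxE (negPf lm) mulr0 add0r => /eqP.
    by rewrite mulf_eq0 (negPf y0)/= => /eqP.
  split=> //; move/matrixP : xy => /(_ m 0).
  by rewrite y0 scale0r addr0 !mxE !eqxx mulr1.
have M0E : M0 = mkgrass fM.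
  apply: (cvg_grass_unique MM0).
  have cM' : two (U t *m e m) (U t *m b t) @[t --> F] --> two (U0 *m e m) (U0
    *m b0).
    by apply: cvg_two; apply: cvg_mulmx => //; exact: cvg_cst.
  by apply: (cvg_grass cM') => // t; have [] := bP t.
(* [M0] contains a vector with nonzero [i]-coordinate, and [e m] contributes nothing to that
   coordinate. *)
have b0i : b0 i 0 != 0.
  move: cM; rewrite M0E => /two_spanP[[x y]]/=; rewrite !scalemxAr -mulmxDr.
  move=> /(congr1 (mulmx (invmx U0))); rewrite !mulKmx// => cE.
  apply: contraNneq ci => b0i; rewrite cE !mxE b0i (negPf im) !mulr0 addr0//.
have AUE t c' : val (A t) *m (U t *m c') = W t *m (diag_mx (d t) *m c').
  by rewrite !mulmxA AUW.
have De t l : diag_mx (d t) *m e l = d t 0 l *: e l.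
  apply/matrixP => x y; rewrite mul_diag_mx !mxE.
  by case: eqP => [->|]; rewrite ?mulr0.
pose bt t := (d t 0 i)^-1 *: (diag_mx (d t) *m b t).
have AM t : val (GL_act (A t) (M t)) = <<cols (two (W t *m e m) (W t *m bt t))>>%VS.
  have [_ _ Mt] := bP t; rewrite (GL_act_two _ Mt) !AUE De.
  rewrite -scalemxAr (_ : W t *m (diag_mx (d t) *m b t) = d t 0 i *: (W t *m bt t)).
    by rewrite span_twoZ.
  by rewrite /bt -scalemxAr scalerA divff// scale1r.
have AL t : val (GL_act (A t) (L (U t) (uU t) s)) =
    <<cols (two (W t *m e j) (W t *m ((d t 0%R k / d t 0%R i) *: e k + s *: e
      i)))>>%VS.
  have Lt : val (L (U t) (uU t) s) =
      <<cols (two (U t *m e j) (U t *m (e k + s *: e i)))>>%VS by [].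
  rewrite (GL_act_two _ Lt) !AUE mulmxDr -scalemxAr !De.
  rewrite -scalemxAr.
  rewrite (_ : d t 0 k *: e k + _ =
      d t 0 i *: ((d t 0 k / d t 0 i) *: e k + s *: e i)); last first.
    by rewrite scalerDr !scalerA mulrCA divff// mulr1 [s * _]mulrC.
  by rewrite -[W t *m (_ *: (_ + _))]scalemxAr span_twoZ.
(* Nothing is known about the ratio of [d t 0 m] to [d t 0 i]; it does no harm because [b t] has no
   [m]-coordinate. *)
have btl : bt t @[t --> F] --> b0 i 0 *: e i.
  apply/cvg_mxP => l z; rewrite [z]ord1 !mxE andbT.
  rewrite (_ : (fun t => _) = (fun t => d t 0 l / d t 0 i * b t l 0)); last first.
    by apply/funext => t; rewrite /bt mxE mul_diag_mx mxE; ring.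
  have bl l' : b t l' 0 @[t --> F] --> b0 l' 0 by move/cvg_mxP : bb0.
  have [->|->|->|->] := ord4_uniqP us l.
  - rewrite eqxx mulr1 (_ : (fun t => _) = (fun t => b t i 0)); first exact: bl.
    by apply/funext => t; rewrite divff// mul1r.
  - rewrite eq_sym (negPf im) mulr0 (_ : (fun t => _) = cst 0);
      first exact: cvg_cst.
    by apply/funext => t; have [-> _ _] := bP t; rewrite mulr0.
  - by rewrite (negPf ji) mulr0 -[X in _ --> X](mul0r (b0 j 0)); exact: cvgM.
  - by rewrite (negPf ki) mulr0 -[X in _ --> X](mul0r (b0 k 0)); exact: cvgM.
have fN1 : free (cols (two (W0 *m e j) (W0 *m (s *: e i)))).
  apply: free_two_unit => // x y xy; have /matrixP E := xy.
  have := E i 0; have := E j 0; rewrite !mxE !eqxx (negPf ji) (negPf ij)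
    !(mulr0, mulr1, addr0, add0r).
  by move=> -> /eqP; rewrite mulf_eq0 (negPf s0) orbF => /eqP.
have fN2 : free (cols (two (W0 *m e m) (W0 *m (b0 i 0 *: e i)))).
  apply: free_two_unit => // x y xy; have /matrixP E := xy.
  have := E i 0; have := E m 0; rewrite !mxE !eqxx [m == i]eq_sym (negPf im)
    !(mulr0, mulr1, addr0, add0r).
  by move=> -> /eqP; rewrite mulf_eq0 (negPf b0i) orbF => /eqP.
have cN1 : GL_act (A t) (L (U t) (uU t) s) @[t --> F] --> (mkgrass fN1 : pg_line R).
  suff cW : two (W t *m e j) (W t *m ((d t 0 k / d t 0 i) *: e k + s *: e i))
    @[t --> F] -->
      two (W0 *m e j) (W0 *m (s *: e i)) by exact: (cvg_grass cW).
  apply: cvg_two; apply: cvg_mulmx => //; first exact: cvg_cst.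
  rewrite -[X in _ --> X]add0r; apply: cvgD; last exact: cvg_cst.
  by rewrite -[X in _ --> X](scale0r (e k)); exact: cvgZr_tmp.
have cN2 : GL_act (A t) (M t) @[t --> F] --> (mkgrass fN2 : pg_line R).
  suff cW : two (W t *m e m) (W t *m bt t) @[t --> F] -->
      two (W0 *m e m) (W0 *m (b0 i 0 *: e i)) by exact: (cvg_grass cW).
  by apply: cvg_two; apply: cvg_mulmx => //; exact: cvg_cst.
have N21 : Pi (mkgrass fN2) (mkgrass fN1).
  apply: (parallel_cvg Pi_top _ cN2 cN1 (x := fun t => W t *m e m) (x0 := W0 *m
    e m)).
  - by apply: cvg_mulmx => //; exact: cvg_cst.
  - by move=> t; apply: aA; exact: (MP t).2.
  - move=> t; rewrite AM; apply/two_spanP; exists (1, 0) => /=.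
    by rewrite scale1r scale0r addr0.
  - by move=> t; exact: unit_e_neq0.
  - exact: unit_e_neq0.
have N2E : mkgrass fN2 = mkgrass fN1 :> pg_line R.
  apply: (parallel_meet_eq (x := W0 *m e i) N21); first exact: unit_e_neq0.
    apply/two_spanP; exists (0, (b0 i 0)^-1) => /=.
    by rewrite scale0r add0r -scalemxAr scalerA mulVf// scale1r.
  apply/two_spanP; exists (0, s^-1) => /=.
  by rewrite scale0r add0r -scalemxAr scalerA mulVf// scale1r.
have : W0 *m e m \in val (mkgrass fN1 : pg_line R).
  rewrite -N2E; apply/two_spanP; exists (1, 0) => /=.
  by rewrite scale1r scale0r addr0.
move=> /two_spanP[[x y]] /=; rewrite !scalemxAr -mulmxDr.
move=> /(congr1 (mulmx (invmx W0))); rewrite !mulKmx// => /matrixP/(_ m 0)/eqP.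
rewrite !mxE eqxx (negPf mj) [m == i]eq_sym (negPf im).
by rewrite !mulr0 addr0 oner_eq0.
Qed.

End Dynamics.

(** * Gaussian elimination with uniform bounds *)

Section Pivoting.
Context {R : realType}.

(* Gaussian elimination with complete pivoting: the multipliers are at most 1
   in absolute value, which bounds U and W independently of A. *)
Lemma pivot_decomposition n : exists2 C : R, 1 <= C & forall A : 'M[R]_n,
  exists U W : 'M[R]_n, exists d : 'rV[R]_n,
  [/\ A *m U = W *m diag_mx d,
      forall i j, `|U i j| <= C /\ `|W i j| <= C,
      `|\det U| = 1 /\ `|\det W| = 1,
      forall m : R, (forall i j, `|A i j| <= m) -> forall i, `|d 0 i| <= C * m &
      forall i j : 'I_n, (i <= j)%N -> `|d 0 j| <= C * `|d 0 i| ].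
Proof.
elim: n => [|n [C C1 IH]].
  exists 1 => // A; exists 1%:M, 1%:M, 0; rewrite det1 normr1.
  by split=> //; [rewrite !thinmx0|move=> []|move=> ? ? []|move=> []].
have C0 : 0 <= C by exact: le_trans C1.
have nC0 : 0 <= n%:R * C by rewrite mulr_ge0.
(* The summand [n%:R * C] bounds the new row of [X], [2 * C] the pivots of the Schur complement,
   whose entries are at most twice the pivot [a], and 1 the entries created by the unit blocks and
   by [a^-1 *: c]. *)
exists (n%:R * C + 2 * C + 1) => [|A]; first by lra.
set C' := n%:R * C + 2 * C + 1.
have C'1 : 1 <= C' by rewrite /C'; lra.
have C'0 : 0 <= C' by lra.
have [->|A0] := eqVneq A 0.
  exists 1%:M, 1%:M, 0; rewrite det1 normr1; split=> //.
  - by rewrite mul0mx linear0 mulmx0.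
  - by move=> i j; rewrite !mxE; case: eqP; rewrite ?normr1 ?normr0//; split; lra.
  - by move=> m mA i; rewrite mxE normr0 mulr_ge0//; exact: le_trans (mA i i).
  - by move=> i j _; rewrite !mxE normr0 mulr0.
have [i0 [j0 Amax]] : exists i0, exists j0, forall i j, `|A i j| <= `|A i0 j0|.
  have [p _ pmax] := @arg_maxP _ _ _ (ord0, ord0 : 'I_n.+1) xpredT
    (fun p : 'I_n.+1 * 'I_n.+1 => `|A p.1 p.2|) isT.
  by exists p.1, p.2 => i j; exact: (pmax (i, j)).
set a := A i0 j0 in Amax.
have a0 : a != 0.
  apply: contra_neq A0 => a0; apply/matrixP => i j; rewrite mxE.
  by apply/eqP; rewrite -normr_le0 -(normr0 R) -a0 Amax.
have na0 : 0 < `|a| by rewrite normr_gt0.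
pose B : 'M[R]_(1 + n) := xrow i0 ord0 (xcol j0 ord0 A).
have BA i j : `|B i j| <= `|a| by rewrite !mxE.
pose b := ursubmx B; pose c := dlsubmx B; pose D := drsubmx B.
have BE : B = block_mx a%:M b c D.
  rewrite -[LHS]submxK; congr block_mx; apply/matrixP => i j.
  by rewrite !ord1 !mxE !lshift0 !tpermR.
have bA i j : `|b i j| <= `|a|.
  by have := BA (lshift n i) (rshift 1 j); rewrite BE block_mxEur.
have cA i j : `|c i j| <= `|a|.
  by have := BA (rshift 1 i) (lshift n j); rewrite BE block_mxEdl.
have DA i j : `|D i j| <= `|a|.
  by have := BA (rshift 1 i) (rshift 1 j); rewrite BE block_mxEdr.
(* The Schur complement of the pivot. The clause bounding pivots by entries is applied to it in
   order to compare the later pivots with [a]. *)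
pose D' := D - a^-1 *: (c *m b).
have D'a i j : `|D' i j| <= 2 * `|a|.
  rewrite mxE (le_trans (ler_normD _ _))// mulr_natl mulr2n lerD//.
  rewrite mxE mxE normrN normrM mxE big_ord1 normrM normfV ler_pdivrMl//.
  by rewrite ler_pM.
have [U' [W' [d' [E bd [dU dW] dm ds]]]] := IH D'.
pose X : 'M[R]_(1 + n) := block_mx 1%:M (- (a^-1 *: (b *m U'))) 0 U'.
pose Y : 'M[R]_(1 + n) := block_mx 1%:M 0 (a^-1 *: c) W'.
pose d : 'rV[R]_(1 + n) := row_mx a%:M d'.
have BXY : B *m X = Y *m diag_mx d.
  have da : diag_mx (a%:M : 'M[R]_1) = a%:M by rewrite -(diag_const_mx 1 a);
    congr diag_mx; apply/matrixP => i j; rewrite !mxE !ord1.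
  rewrite BE /X /Y /d diag_mx_row da !mulmx_block !(mulmx0, mul0mx, addr0,
    add0r, mulmx1, mul1mx).
  congr block_mx.
  - by rewrite mulmxN mul_scalar_mx scalerA divff// scale1r addNr.
  - by rewrite -scalemxAl mul_mx_scalar scalerA mulVf// scale1r.
  - by rewrite mulmxN -scalemxAr mulmxA -E /D' mulmxBl -scalemxAl addrC.
have WU i j : `|X i j| <= C' /\ `|Y i j| <= C'.
  rewrite /X /Y; split; rewrite mxE; case: (fintype.split i) => i'; rewrite mxE;
    case: (fintype.split j) => j'.
  - by rewrite mxE; case: eqP; rewrite ?normr1 ?normr0.
  - rewrite mxE mxE normrN normrM mxE normfV ler_pdivrMl//.
    apply: le_trans (ler_norm_sum _ _ _) _.
    have le1 k : `|b i' k * U' k j'| <= `|a| * C.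
      by rewrite normrM ler_pM//; case: (bd k j').
    apply: le_trans (ler_sum _ (fun k _ => le1 k)) _.
    by rewrite sumr_const card_ord -mulrnAr ler_pM2l// -mulr_natl /C'; lra.
  - by rewrite mxE normr0.
  - by have [h _] := bd i' j'; apply: le_trans h _; rewrite /C'; lra.
  - by rewrite mxE; case: eqP; rewrite ?normr1 ?normr0.
  - by rewrite mxE normr0.
  - rewrite mxE normrM normfV ler_pdivrMl// (le_trans (cA _ _))// -[leLHS]mulr1.
    by rewrite ler_wpM2l.
  - by have [_ h] := bd i' j'; apply: le_trans h _; rewrite /C'; lra.
have tp k : tperm_mx k ord0 *m tperm_mx k ord0 = 1%:M :> 'M[R]_n.+1.
  by rewrite /tperm_mx -perm_mxM tperm2 perm_mx1.
have dtp k (M : 'M[R]_n.+1) : `|\det (xrow k ord0 M)| = `|\det M|.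
  by rewrite xrowE det_mulmx det_perm normrM normrX normrN1 expr1n mul1r.
(* The column exchange made in [A] is absorbed as a row exchange of [X], and the row exchange is
   undone in [Y]. *)
exists (xrow j0 ord0 X), (xrow i0 ord0 Y), d; split.
- rewrite [xrow j0 _ _]xrowE [xrow i0 _ _]xrowE -mulmxA -BXY /B xrowE xcolE !mulmxA.
  by rewrite tp mul1mx.
- by move=> i j; split; rewrite mxE; [exact: (WU _ _).1|exact: (WU _ _).2].
- have dX : \det X = \det U' by rewrite /X det_ublock det1 mul1r.
  have dY : \det Y = \det W' by rewrite /Y det_lblock det1 mul1r.
  by rewrite !dtp [\det X]dX [\det Y]dY.
- move=> m mA i; have am : `|a| <= m by exact: mA.
  have m0 : 0 <= m by exact: le_trans am.
  rewrite /d mxE; case: (@fintype.split 1 n i) => i'.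
    rewrite !ord1 mxE mulr1n; apply: le_trans am _; rewrite -[leLHS]mul1r;
      exact: ler_wpM2r.
  apply: le_trans (dm _ D'a i') _; rewrite mulrA.
  apply: le_trans (ler_wpM2l _ am) _; first by rewrite mulr_ge0.
  by rewrite ler_wpM2r// /C'; lra.
- move=> i j; rewrite /d !mxE.
  case: (@fintype.splitP 1 n i) => i' ->; case: (@fintype.splitP 1 n j) => j' ->;
    rewrite ?ord1 ?mxE ?mulr1n.
  + by move=> _; rewrite -[leLHS]mul1r; exact: ler_wpM2r.
  + move=> _; apply: le_trans (dm _ D'a j') _; rewrite mulrA ler_wpM2r// /C'; lra.
  + by [].
  + rewrite leq_add2l => ij; apply: le_trans (ds _ _ ij) _.
    by rewrite ler_wpM2r// /C'; lra.
Qed.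
End Pivoting.

(** * Boundedness of the normalized automorphisms *)

Lemma aut_GL_bounded (R : realType) (Pi : parallelism R) :
  topological_parallelism Pi ->
  exists K : R, forall A : GL R 4, aut_GL Pi A -> `|\det (val A)| = 1 -> `|val
    A| <= K.
Proof.
move=> Pi_top; apply: contrapT => nK.
have /choice[A AP] (n : nat) : exists A : GL R 4,
    [/\ aut_GL Pi A, `|\det (val A)| = 1 & n.+1%:R < `|val A| ].
  apply: contrapT => nA; apply: nK; exists n.+1%:R => A aA dA.
  by rewrite leNgt; apply/negP => ltA; apply: nA; exists A.
have [C C1 dec] := @pivot_decomposition R 4.
have C0 : 0 <= C by exact: le_trans C1.
have /choice[U /choice[W /choice[d dP]]] n := dec (val (A n)).
have [F [UF ooF]] := ultraFilterLemma eventually_filter.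
have UdetN n : `|\det (U n)| = 1 by have [_ _ []] := dP n.
have WdetN n : `|\det (W n)| = 1 by have [_ _ []] := dP n.
have unitN (V : 'M[R]_4) : `|\det V| = 1 -> V \in unitmx.
  by move=> dV; rewrite unitmxE unitfE -normr_eq0 dV oner_eq0.
have unit_lim (V : nat -> 'M[R]_4) (V0 : 'M[R]_4) : (forall n, `|\det (V n)| = 1) ->
    V t @[t --> F] --> V0 -> V0 \in unitmx.
  move=> dV VV0; apply: unitN.
  have : `|\det (V t)| @[t --> F] --> `|\det V0| by apply: cvg_norm; exact: cvg_det.
  rewrite (_ : (fun t => _) = cst 1); last by apply/funext => t; rewrite dV.
  by move=> h; apply: (cvgR_unique _ h); exact: cvg_cst.
have [U0 UU0 _] : exists2 U0 : 'M[R]_4, U t @[t --> F] --> U0 & forall i j,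
  `|U0 i j| <= C.
  by apply: ultra_cvg_mx => n i j; have [_ /(_ i j)[]] := dP n.
have [W0 WW0 _] : exists2 W0 : 'M[R]_4, W t @[t --> F] --> W0 & forall i j,
  `|W0 i j| <= C.
  by apply: ultra_cvg_mx => n i j; have [_ /(_ i j)[]] := dP n.
have uU0 := unit_lim _ _ UdetN UU0; have uW0 := unit_lim _ _ WdetN WW0.
have uU n := unitN _ (UdetN n); have uW n := unitN _ (WdetN n).
have AUW n : val (A n) *m U n = W n *m diag_mx (d n) by have [] := dP n.
have prodd n : `|\prod_l d n 0 l| = 1.
  have /(congr1 (fun V => `|\det V|)) := AUW n.
  by rewrite /= !det_mulmx !normrM UdetN WdetN det_diag mul1r mulr1 => <-;
    have [] := AP n.
have d0 n l : d n 0 l != 0.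
  apply: contra_eq_neq (prodd n) => dl0.
  by rewrite (bigD1 l)//= dl0 mul0r normr0 eq_sym oner_eq0.
have dle n (i j : 'I_4) : (i <= j)%N -> `|d n 0 j| <= C * `|d n 0 i| by have [_
  _ _ _] := dP n; exact.
pose r n : 'rV[R]_4 := (d n 0 ord0)^-1 *: d n.
have [r0 rr0 _] : exists2 r0 : 'rV[R]_4, r t @[t --> F] --> r0 & forall i j,
  `|r0 i j| <= C.
  apply: ultra_cvg_mx => n i l; rewrite ord1 mxE normrM normfV ler_pdivrMl
    ?normr_gt0//.
  by rewrite mulrC dle.
have rl l : d t 0 l / d t 0 ord0 @[t --> F] --> r0 0 l.
  rewrite (_ : (fun t => _) = (fun t => r t 0 l)); first by move/cvg_mxP : rr0.
  by apply/funext => t; rewrite mxE mulrC.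
(* Dividing [A t] by its first pivot gives a convergent family, whereas the norm of [A t] tends to
   infinity. *)
have dinv0 : (d t 0 ord0)^-1 @[t --> F] --> 0.
  have AE t : (d t 0 ord0)^-1 *: val (A t) = W t *m diag_mx (r t) *m invmx (U t).
    by rewrite -[val (A t)](mulmxK (uU t)) AUW /r linearZ/= -scalemxAr -scalemxAl.
  have cA : `|(d t 0 ord0)^-1 *: val (A t)| @[t --> F] --> `|W0 *m diag_mx r0
    *m invmx U0|.
    apply: cvg_norm; rewrite (_ : (fun t => _) =
      (fun t => W t *m diag_mx (r t) *m invmx (U t))); last by apply/funext => t;
        exact: AE.
    apply: cvg_mulmx; last exact: cvg_invmx.
    apply: cvg_mulmx => //; apply/cvg_mxP => i j; rewrite mxE.
    under eq_fun do rewrite mxE.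
    case: eqP => _; last by under eq_fun do rewrite mulr0n; exact: cvg_cst.
    by under eq_fun do rewrite mulr1n; move/cvg_mxP : rr0 => /(_ 0 i).
  have iA : `|val (A t)|^-1 @[t --> F] --> (0 : R).
    apply: (@squeeze_cvgr _ _ _ _ (cst 0) (fun n => n.+1%:R^-1)).
    - apply: filterE => n; rewrite invr_ge0 normr_ge0/= lef_pV2 ?posrE ?ltr0n//.
        by have [_ _ /ltW] := AP n.
      by have [_ _] := AP n; exact: lt_trans.
    - exact: cvg_cst.
    - by apply: cvg_trans (@cvg_harmonic R); move=> Q /= /ooF.
  apply: norm_cvg0; rewrite -(mulr0 `|W0 *m diag_mx r0 *m invmx U0|).
  rewrite (_ : (fun t => _) = (fun t => `|(d t 0 ord0)^-1 *: val (A t)| * `|val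
    (A t)|^-1)).
    exact: cvgM.
  apply/funext => t; rewrite normrZ mulfK// gt_eqF//.
  by have [_ _] := AP t; exact: lt_trans.
(* The product of the four ratios has the absolute value of the fourth power of [(d t 0 ord0)^-1],
   hence tends to 0. *)
have [l rl0] : exists l, r0 0 l = 0.
  have prod0 : \prod_l r0 0 l = 0.
    have c1 : `|\prod_l (d t 0 l / d t 0 ord0)| @[t --> F] --> `|\prod_l r0 0 l|.
      by apply: cvg_norm; apply: cvg_prod => l; exact: rl.
    have c2 : `|\prod_l (d t 0 l / d t 0 ord0)| @[t --> F] --> (0 : R).
      rewrite (_ : (fun t => _) = (fun t => `|\prod_(l < 4) (d t 0 ord0)^-1|)).
        rewrite -(@normr0 _ R); apply: cvg_norm.
        rewrite -[X in _ --> X](_ : \prod_(l < 4) (0 : R) = 0);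
          last by rewrite big_const_ord /= mul0r.
        by apply: cvg_prod => l.
      by apply/funext => t; rewrite big_split normrM prodd mul1r.
    by apply/eqP; rewrite -normr_eq0 (cvgR_unique _ c1 c2).
  by move/eqP: prod0; rewrite prodf_seq_eq0 => /hasP[l _ /eqP h]; exists l.
pose o k : 'I_4 := inord k.
have o0 : ord0 = o 0%N by apply/val_inj; rewrite /= inordK.
have neqo a b : (a < 4)%N -> (b < 4)%N -> (o a == o b) = (a == b).
  by move=> a4 b4; rewrite -val_eqE /= !inordK.
(* Pivots decrease up to the factor [C], so whichever ratio vanishes in the limit, the last one does
   too. *)
have r3 : r0 0 (o 3%N) = 0.
  have le3 t : `|d t 0 (o 3%N) / d t 0 ord0| <= C * `|d t 0 l / d t 0 ord0|.
    rewrite !normrM mulrA ler_wpM2r// dle// /= inordK//; exact: (ltn_ord l).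
  apply: (cvgR_unique _ (rl (o 3%N))); apply: norm_cvg0.
  apply: (@squeeze_cvgr _ _ _ _ (cst 0) (fun t => C * `|d t 0 l / d t 0 ord0|)).
  - by apply: filterE => t; rewrite normr_ge0 le3.
  - exact: cvg_cst.
  - rewrite -(mulr0 C) -(@normr0 _ R) -rl0; apply: cvgM; first exact: cvg_cst.
    by apply: cvg_norm; exact: rl.
have [r2|r2] := eqVneq (r0 0 (o 2%N)) 0.
  apply: (@aut_no_contraction R Pi Pi_top nat F UF A U W U0 W0 d (o 0) (o 1) (o
    2) (o 3))%N => //.
  - by move=> t; have [] := AP t.
  - by rewrite /= !inE !neqo.
  - by rewrite -o0 -r2; exact: rl.
  - by rewrite -o0 -r3; exact: rl.
(* For the inverses [U] and [W] exchange roles and the pivots are inverted: now index 3 dominates 2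
   and 0. *)
pose d' t : 'rV[R]_4 := \row_l (d t 0 l)^-1.
apply: (@aut_no_contraction R Pi Pi_top nat F UF (fun t => GL_inv (A t)) W U W0 U0
  d' (o 3) (o 1) (o 2) (o 0))%N => //.
- by move=> t; apply: aut_GL_inv; have [] := AP t.
- move=> t /=; rewrite -[RHS](mulKmx (Defs.GL_unit (A t))); congr (_ *m _).
  rewrite mulmxA AUW -mulmxA -[LHS]mulmx1; congr (_ *m _).
  apply/matrixP => x y; rewrite mul_diag_mx !mxE.
  by case: eqP => [->|]; rewrite ?mulr0// mulfV.
- by move=> t l'; rewrite mxE invr_eq0.
- by rewrite /= !inE !neqo.
- have c3 : d t 0 (o 3%N) / d t 0 ord0 * (d t 0 (o 2%N) / d t 0 ord0)^-1 @[t
    --> F] -->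
      r0 0 (o 3%N) * (r0 0 (o 2%N))^-1.
    by apply: cvgM => //; exact: cvgV.
  rewrite r3 mul0r in c3.
  rewrite (_ : (fun t => _) = (fun t => d t 0 (o 3%N) / d t 0 ord0 *
    (d t 0 (o 2%N) / d t 0 ord0)^-1))//.
  by apply/funext => t; rewrite !mxE; field; rewrite !d0.
- rewrite (_ : (fun t => _) = (fun t => d t 0 (o 3%N) / d t 0 ord0)).
    by rewrite -r3; exact: rl.
  by apply/funext => t; rewrite !mxE invrK o0 mulrC.
Qed.

(** * Invariant quadratic forms *)

Section MatrixNorms.
Context {R : realType}.

Lemma entry_le_norm m n (X : 'M[R]_(m, n)) i j : `|X i j| <= `|X|.
Proof. by rewrite [leRHS]/Num.Def.normr/= mx_normrE;
  exact: (le_bigmax _ _ (i, j)). Qed.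

Lemma mx_norm_le m n (X : 'M[R]_(m, n)) B : 0 <= B ->
  (forall i j, `|X i j| <= B) -> `|X| <= B.
Proof.
by move=> B0 XB; rewrite [leLHS]/Num.Def.normr/= mx_normrE (bigmax_le _ B0).
Qed.

(** The norm is the largest absolute value of an entry, and an entry of the product is a sum of [n]
    terms; hence the factor. *)
Lemma mx_norm_mul m n p (X : 'M[R]_(m, n)) (Y : 'M[R]_(n, p)) :
  `|X *m Y| <= n%:R * (`|X| * `|Y|).
Proof.
apply: mx_norm_le => [|i j]; first by rewrite !mulr_ge0.
rewrite mxE (le_trans (ler_norm_sum _ _ _))//.
have le1 k : `|X i k * Y k j| <= `|X| * `|Y|.
  by rewrite normrM ler_pM// entry_le_norm.
by apply: le_trans (ler_sum _ (fun k _ => le1 k)) _;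
  rewrite sumr_const card_ord mulr_natl.
Qed.

Lemma mx_norm_tr m n (X : 'M[R]_(m, n)) : `|X^T| <= `|X|.
Proof. by apply: mx_norm_le => // i j; rewrite mxE entry_le_norm. Qed.

(** The square of the Frobenius norm, chosen because it is strictly convex, which the entrywise
    maximum is not. *)
Definition frob m n (X : 'M[R]_(m, n)) : R := \sum_i \sum_j X i j ^+ 2.

Lemma frob_ge0 m n (X : 'M[R]_(m, n)) : 0 <= frob X.
Proof. by apply: sumr_ge0 => i _; apply: sumr_ge0 => j _; exact: sqr_ge0. Qed.

Lemma norm_le_frob m n (X : 'M[R]_(m, n)) : `|X| ^+ 2 <= frob X.
Proof.
have entry i j : X i j ^+ 2 <= frob X.
  rewrite /frob (bigD1 i)//= (bigD1 j)//= -addrA lerDl addr_ge0//.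
    by apply: sumr_ge0 => ? _; exact: sqr_ge0.
  by apply: sumr_ge0 => ? _; apply: sumr_ge0 => ? _; exact: sqr_ge0.
have f0 := frob_ge0 X.
rewrite -(sqr_sqrtr f0) ler_sqr ?nnegrE ?sqrtr_ge0//.
apply: mx_norm_le; rewrite ?sqrtr_ge0// => i j.
by rewrite -sqrtr_sqr ler_wsqrtr.
Qed.

Lemma frob_le_norm m n (X : 'M[R]_(m, n)) : frob X <= (m * n)%:R * `|X| ^+ 2.
Proof.
have le1 i j : X i j ^+ 2 <= `|X| ^+ 2.
  by rewrite -real_normK ?num_real// ler_sqr ?nnegrE// entry_le_norm.
have le2 i : \sum_j X i j ^+ 2 <= n%:R * `|X| ^+ 2.
  apply: le_trans (ler_sum _ (fun j _ => le1 i j)) _.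
  by rewrite sumr_const card_ord mulr_natl.
apply: le_trans (ler_sum _ (fun i _ => le2 i)) _.
by rewrite sumr_const card_ord natrM -[leRHS]mulrA [leRHS]mulr_natl.
Qed.

Lemma frob_parallelogram m n (X Y : 'M[R]_(m, n)) :
  frob (2^-1 *: (X + Y)) = 2^-1 * (frob X + frob Y) - 4^-1 * frob (X - Y).
Proof.
rewrite /frob -big_split/= mulr_sumr mulr_sumr -sumrB; apply: eq_bigr => i _.
rewrite -big_split/= mulr_sumr mulr_sumr -sumrB; apply: eq_bigr => j _.
by rewrite !mxE; field.
Qed.

Lemma frob_eq0 m n (X : 'M[R]_(m, n)) : frob X = 0 -> X = 0.
Proof.
move=> X0; apply/eqP; rewrite -normr_eq0 -sqrf_eq0 eq_le sqr_ge0 andbT.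
by rewrite -[leRHS]X0 norm_le_frob.
Qed.

Lemma cvg_frob (T : Type) (F : set_system T) (FF : Filter F) m n
    (f : T -> 'M[R]_(m, n)) (X : 'M[R]_(m, n)) :
  f t @[t --> F] --> X -> frob (f t) @[t --> F] --> frob X.
Proof.
move=> /cvg_mxP fX; apply: cvg_sum => i; apply: cvg_sum => j.
by rewrite expr2; under eq_fun do rewrite expr2; exact: cvgM.
Qed.

End MatrixNorms.

Section InvariantForm.
Context {R : realType} {n : nat}.

Definition qform (Q : 'M[R]_n) (x : 'cV[R]_n) : R := (x^T *m Q *m x) 0 0.

Lemma qform_act (Q g : 'M[R]_n) x : qform (g^T *m Q *m g) x = qform Q (g *m x).
Proof. by rewrite /qform trmx_mul !mulmxA. Qed.

Variables (G : set 'M[R]_n) (K : R).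
Hypotheses (G1 : G 1%:M) (GM : forall g h, G g -> G h -> G (g *m h)).
Hypotheses (Gu : forall g, G g -> g \in unitmx) (GV : forall g, G g -> G (invmx g)).
Hypothesis GK : forall g, G g -> `|g| <= K.

Let K0 : 0 <= K. Proof. exact: le_trans (GK G1). Qed.

(* The forms Q whose whole G-orbit is bounded below by the sup norm and has
   Frobenius norm at most r. For the least r for which they exist, they form a
   G-invariant set, reduced to a point by the parallelogram identity. *)
Let E (r : R) : set 'M[R]_n := [set Q | [/\ Q^T = Q,
  forall g x, G g -> `|x| ^+ 2 <= qform Q (g *m x) &
  forall g, G g -> frob (g^T *m Q *m g) <= r]].

Let E_act r Q h : G h -> E r Q -> E r (h^T *m Q *m h).
Proof.
move=> Gh [Qs Qp Qr]; split.
- by rewrite !trmx_mul trmxK Qs mulmxA.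
- by move=> g x Gg; rewrite qform_act mulmxA; apply: Qp; exact: GM.
- move=> g Gg; have := Qr _ (GM Gh Gg); rewrite trmx_mul !mulmxA; exact.
Qed.

Let frob_act_le g X : G g -> frob (g^T *m X *m g) <=
  (n * n)%:R * (n%:R * (n%:R * (K * `|X|) * K)) ^+ 2.
Proof.
move=> Gg; apply: le_trans (frob_le_norm _) _; rewrite ler_wpM2l//.
rewrite ler_sqr ?nnegrE ?mulr_ge0//; apply: le_trans (mx_norm_mul _ _) _.
rewrite ler_wpM2l// ler_pM ?GK//; apply: le_trans (mx_norm_mul _ _) _.
by rewrite ler_wpM2l// ler_wpM2r// (le_trans (mx_norm_tr _)) ?GK.
Qed.

Let E_nonempty : exists r Q, E r Q.
Proof.
(* This multiple of the identity compensates for the contraction by [g]: as x is the image of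
   [g *m x] under [invmx g], its norm is at most [n%:R * K] times that of [g *m x]. *)
pose l := (n%:R * K) ^+ 2; pose Q : 'M[R]_n := l%:M.
exists ((n * n)%:R * (n%:R * (n%:R * (K * `|Q|) * K)) ^+ 2), Q; split.
- exact: tr_scalar_mx.
- move=> g x Gg; rewrite /qform mul_mx_scalar -scalemxAl mxE.
  have -> : ((g *m x)^T *m (g *m x)) 0 0 = frob (g *m x).
    by rewrite mxE /frob; apply: eq_bigr => i _; rewrite big_ord1 mxE expr2.
  apply: le_trans (_ : l * `|g *m x| ^+ 2 <= _); last first.
    by rewrite ler_wpM2l ?sqr_ge0// norm_le_frob.
  rewrite -exprMn ler_sqr ?nnegrE ?mulr_ge0// -{1}(mulKmx (Gu Gg) x).
  apply: le_trans (mx_norm_mul _ _) _.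
  by rewrite mulrA ler_wpM2r// ler_wpM2l// GK//; exact: GV.
- by move=> g Gg; exact: frob_act_le.
Qed.

(** Near-minimizers converge along an ultrafilter to a form attaining the infimum. The lower bound
    by the squared norm is a closed condition, so positive definiteness is not lost in the limit. *)
Lemma invariant_form : exists Q : 'M[R]_n,
  [/\ Q^T = Q, forall x, x != 0 -> 0 < qform Q x & forall g, G g -> g^T *m Q *m
    g = Q].
Proof.
pose S := [set r : R | exists Q, E r Q].
have S0 : lbound S 0.
  by move=> r [Q [_ _ /(_ _ G1)]]; apply: le_trans; exact: frob_ge0.
have hS : has_inf S by split; [exact: E_nonempty|exists 0].
pose r := inf S.
have /choice[q qE] (k : nat) : exists q, E (r + k.+1%:R^-1) q.
  have [s [q [qs qp qr]] sr] : exists2 s, S s & s < r + k.+1%:R^-1.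
    by apply: inf_adherent => //; rewrite invr_gt0.
  by exists q; split=> // g Gg; apply: le_trans (qr g Gg) (ltW sr).
have [F [UF ooF]] := ultraFilterLemma eventually_filter.
have r0 : 0 <= r by exact: lb_le_inf.
have [Q qQ _] : exists2 Q : 'M[R]_n, q t @[t --> F] --> Q &
    forall i j, `|Q i j| <= Num.sqrt (r + 1).
  apply: ultra_cvg_mx => k i j; apply: le_trans (entry_le_norm _ _ _) _.
  rewrite -(@ger0_norm _ `|q k|)// -sqrtr_sqr ler_wsqrtr//.
  apply: le_trans (norm_le_frob _) _.
  have [_ _ /(_ _ G1)] := qE k; rewrite trmx1 mul1mx mulmx1 => /le_trans; apply.
  by rewrite lerD2l invf_le1// ler1n.
have EQ : E r Q.
  split.
  - have qT : q t @[t --> F] --> Q^T.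
      rewrite (_ : (fun t => _) = (fun t => (q t)^T)); first exact: cvg_trmx.
      by apply/funext => t; have [] := qE t.
    exact: (cvg_unique (@norm_hausdorff _ _) qT qQ).
  - move=> g x Gg.
    have c : qform (q t) (g *m x) @[t --> F] --> qform Q (g *m x).
      suff : (g *m x)^T *m q t *m (g *m x) @[t --> F] --> (g *m x)^T *m Q *m (g
        *m x).
        by move/cvg_mxP => /(_ 0 0).
      by do 2 (apply: cvg_mulmx; last exact: cvg_cst || idtac) => //;
        exact: cvg_cst.
    apply: (cvgr_to_ge c); apply: filterE => t.
    by have [_ h _] := qE t; exact: h.
  - move=> g Gg.
    have c : frob (g^T *m q t *m g) @[t --> F] --> frob (g^T *m Q *m g).
      apply: cvg_frob; apply: cvg_mulmx; last exact: cvg_cst.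
      by apply: cvg_mulmx => //; exact: cvg_cst.
    have c' : r + k.+1%:R^-1 @[k --> F] --> r.
      rewrite -[X in _ --> X]addr0; apply: cvgD; first exact: cvg_cst.
      by apply: cvg_trans (@cvg_harmonic R); move=> P /= /ooF.
    have cd : frob (g^T *m q k *m g) - (r + k.+1%:R^-1) @[k --> F] -->
      frob (g^T *m Q *m g) - r by exact: cvgB.
    rewrite -subr_le0; apply: (cvgr_to_le cd).
    by apply: filterE => k; rewrite subr_le0; have [_ _] := qE k; exact.
have [Qs Qp Qr] := EQ; exists Q; split=> // [x x0|h Gh].
  apply: lt_le_trans (_ : `|x| ^+ 2 <= _); first by rewrite exprn_gt0// normr_gt0.
  by have := Qp _ x G1; rewrite mul1mx.
have EQ' := E_act Gh EQ; set Q' := h^T *m Q *m h in EQ' *.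
have [Qs' Qp' Qr'] := EQ'.
apply/eqP; rewrite eq_sym -subr_eq0; apply/eqP/frob_eq0; apply: contrapT => /eqP f0.
have fgt0 : 0 < frob (Q - Q') by rewrite lt_def f0 frob_ge0.
(* The gain at the midpoint of [Q] and [Q'] must be uniform over the orbit; bounding the action of
   [invmx g] keeps the difference of the two forms away from 0 under every [g]. *)
pose M : R := (n * n)%:R * (n%:R * (n%:R * K * K)) ^+ 2.
have M0 : 0 <= M by rewrite mulr_ge0// sqr_ge0.
have actM g : G g -> frob (Q - Q') <= M * frob (g^T *m (Q - Q') *m g).
  move=> Gg; set X := g^T *m _ *m g.
  have -> : Q - Q' = (invmx g)^T *m X *m invmx g.
    have gT : g^T \in unitmx by rewrite unitmx_tr Gu.
    by rewrite /X !mulmxA -trmx_mul mulmxV ?Gu// trmx1 mul1mx mulmxK// Gu.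
  apply: le_trans (frob_act_le _ (GV Gg)) _.
  rewrite (_ : n%:R * (n%:R * (K * `|X|) * K) = n%:R * (n%:R * K * K) * `|X|);
    last by ring.
  by rewrite exprMn [leLHS]mulrA ler_wpM2l// norm_le_frob.
(* The factor [4^-1] is that of the parallelogram identity; [M + 1] makes the divisor positive even
   if [M] is 0. *)
pose del := 4^-1 * (frob (Q - Q') / (M + 1)).
have del0 : 0 < del by rewrite /del !mulr_gt0 ?invr_gt0 ?ltr_wpDl.
have : S (r - del).
  exists (2^-1 *: (Q + Q')); split.
  - by rewrite linearZ linearD/= Qs Qs'.
  - move=> g x Gg; rewrite /qform -scalemxAr -scalemxAl mxE mulmxDr mulmxDl mxE.
    have := Qp g x Gg; have := Qp' g x Gg; rewrite /qform; lra.
  - move=> g Gg; rewrite -scalemxAr -scalemxAl mulmxDr mulmxDl frob_parallelogram.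
    rewrite -mulmxBl -mulmxBr.
    have h1 := Qr g Gg; have h2 := Qr' g Gg.
    have h3 : frob (Q - Q') / (M + 1) <= frob (g^T *m (Q - Q') *m g).
      rewrite ler_pdivrMr ?ltr_wpDl//; apply: le_trans (actM _ Gg) _.
      by rewrite mulrC ler_wpM2l ?frob_ge0// lerDl.
    rewrite /del; lra.
move=> /(ge_inf hS.2); rewrite -/r; lra.
Qed.

End InvariantForm.

(** Induction on the size: split off the first diagonal entry and factor its Schur complement
    [D']. *)
Lemma cholesky (R : realType) n (Q : 'M[R]_n) : Q^T = Q ->
  (forall x, x != 0 -> 0 < qform Q x) -> exists2 S : 'M[R]_n, S \in unitmx & Q
    = S^T *m S.
Proof.
elim: n Q => [|n IH] Q Qs Qp.
  by exists 1%:M; [exact: unitmx1|apply/matrixP => -[]].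
pose B : 'M[R]_(1 + n) := Q.
pose u := ursubmx B; pose v := dlsubmx B; pose D := drsubmx B; pose a := B 0 0.
have BE : B = block_mx a%:M u v D.
  rewrite -[LHS]submxK; congr block_mx; apply/matrixP => i j.
  by rewrite !ord1 !mxE !lshift0.
have BT : block_mx a%:M u v D = (block_mx a%:M u v D)^T by rewrite -BE; exact: esym.
have [vu Ds] : v = u^T /\ D = D^T by move: BT;
  rewrite tr_block_mx => /eq_block_mx[].
have qD' (y : 'cV[R]_n) : (y^T *m v *m u *m y) 0 0 = (u *m y) 0 0 ^+ 2.
  by rewrite vu -trmx_mul -mulmxA mxE big_ord1 mxE expr2.
have qB (x : R) (y : 'cV[R]_n) : qform B (col_mx x%:M y) =
    a * x ^+ 2 + 2 * x * (u *m y) 0 0 + qform D y.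
  rewrite /qform BE tr_col_mx mul_row_block mul_row_col !mulmxDl vu -trmx_mul.
  rewrite tr_scalar_mx -scalar_mxM !mul_mx_scalar !mul_scalar_mx -scalemxAl
    !mxE eqxx mulr1n; ring.
have a0 : 0 < a.
  have : 0 < qform B (col_mx 1%:M 0).
    apply: Qp; apply/eqP => /(congr1 (@usubmx _ 1 n 1)); rewrite col_mxKu linear0.
    by move/matrixP => /(_ 0 0)/eqP; rewrite !mxE oner_eq0.
  by rewrite qB /qform !mulmx0 !mxE expr1n !mulr1 mulr0 !addr0.
pose D' := D - a^-1 *: (v *m u).
have D's : D'^T = D'.
  by rewrite /D' linearB linearZ/= trmx_mul vu trmxK -Ds.
have qD'E (y : 'cV[R]_n) : qform D' y = qform D y - a^-1 * (u *m y) 0 0 ^+ 2.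
  rewrite -qD' /qform /D' mulmxBr mulmxBl -scalemxAr -scalemxAl !mulmxA.
  by rewrite [LHS]mxE; congr (_ + _); rewrite [LHS]mxE; congr (- _);
    rewrite [LHS]mxE.
(* Completing the square: [qform D' y] is the value of the whole form at the first coordinate that
   minimizes it for given [y]. *)
have D'p y : y != 0 -> 0 < qform D' y.
  move=> y0; have : 0 < qform B (col_mx (- a^-1 * (u *m y) 0 0)%:M y).
    apply: Qp; apply: contra_neq y0 => /(congr1 (@dsubmx _ 1 n 1)).
    by rewrite col_mxKd linear0.
  rewrite qB qD'E => h; apply: lt_le_trans h _; rewrite le_eqVlt; apply/orP; left.
  by apply/eqP; field; rewrite gt_eqF.
have [S' uS' D'E] := IH D' D's D'p.
have sa0 : Num.sqrt a != 0 by rewrite gt_eqF// sqrtr_gt0.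
pose S : 'M[R]_(1 + n) := block_mx (Num.sqrt a)%:M ((Num.sqrt a)^-1 *: u) 0 S'.
exists S.
  have : \det S != 0 by rewrite det_ublock det_scalar1 mulf_neq0// -unitfE -unitmxE.
  by rewrite unitmxE unitfE.
have : B = S^T *m S.
  rewrite BE /S tr_block_mx mulmx_block trmx0 !mul0mx !addr0 !mulmx0 !addr0.
  rewrite tr_scalar_mx -scalar_mxM -expr2 sqr_sqrtr ?ltW//; congr block_mx.
  - by rewrite mul_scalar_mx scalerA divff// scale1r.
  - by rewrite mul_mx_scalar linearZ/= scalerA divff// scale1r.
  - rewrite -D'E [(_ *: u)^T]linearZ/= -scalemxAl -scalemxAr scalerA -invfM
      -expr2 sqr_sqrtr ?ltW//.
    by rewrite -vu /D' addrCA subrr addr0.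
by [].
Qed.

(** * The identity component *)

Section Retract.
Context {T : Type} (E : set T) (t0 : T).

(** Turns a property holding only eventually along a filter into one holding for every index, as the
    limit lemmas require, without changing the filter. *)
Definition retract (t : T) : T := if `[< E t >] then t else t0.

Lemma retractP t : E t0 -> E (retract t).
Proof. by rewrite /retract; case: asboolP. Qed.

Lemma retract_fmap (F : set_system T) : Filter F -> F E -> retract @ F = F.
Proof.
move=> FF FE; apply/seteqP; split=> A FA.
  have FEA : F (E `&` retract @^-1` A) by apply: filterI => //; exact: FA.
  by apply: (filterS _ FEA) => t [Et]; rewrite /= /retract; case: asboolP.
have FEA : F (E `&` A) by exact: filterI.
suff : F (retract @^-1` A) by [].
by apply: (filterS _ FEA) => t [Et At]; rewrite /= /retract; case: asboolP.
Qed.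

End Retract.

Lemma cvg_set_val (T : Type) (F : set_system T) (X : topologicalType) (A : set X)
    (f : T -> set_type A) (s : set_type A) : Filter F ->
  val (f t) @[t --> F] --> val s -> f t @[t --> F] --> s.
Proof.
move=> FF fs O; rewrite nbhsE => -[V [[V' oV' V'V] Vs] VO].
have VE t : V t = V' (val t) by rewrite -V'V /preimage/= set_valE.
have FV' : \forall t \near F, V' (val (f t)).
  by apply: fs; apply: open_nbhs_nbhs; split=> //; rewrite -VE.
by apply: filterS FV' => t; rewrite -VE => /VO.
Qed.

(** * Compactness in GL and continuity of the operations on PGL *)

Section ProjectiveGroup.
Context {R : realType} {n : nat}.

Lemma GL_val_continuous : continuous (val : GL R n -> 'M[R]_n).
Proof. by move=> A; exact: initial_continuous. Qed.

(** The determinant condition keeps limits invertible. The hypothesis on [K] puts the identity into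
    the set, where it serves as the default value of [retract]. *)
Lemma GL_norm_compact (K : R) : (forall i j, `|(1%:M : 'M[R]_n) i j| <= K) ->
  compact [set A : GL R n | `|\det (val A)| = 1 /\ forall i j, `|val A i j| <= K].
Proof.
move=> K1; set E := [set A | _]; rewrite compact_ultra => F UF FE.
have E1 : E (GL_one R n) by split=> //; rewrite /= det1 normr1.
have EP t := retractP t E1.
have [A cA AK] : exists2 A : 'M[R]_n,
    val (retract E (GL_one R n) t) @[t --> F] --> A & forall i j, `|A i j| <= K.
  by apply: ultra_cvg_mx => t i j; have [_] := EP t; exact.
have dA : `|\det A| = 1.
  have : `|\det (val (retract E (GL_one R n) t))| @[t --> F] --> `|\det A|.
    by apply: cvg_norm; exact: cvg_det.
  rewrite (_ : (fun t => _) = cst 1); last by apply/funext => t; have [] := EP t.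
  by move=> h; apply: (cvgR_unique _ h); exact: cvg_cst.
have uA : A \in unitmx by rewrite unitmxE unitfE -normr_eq0 dA oner_eq0.
exists (mkGL uA); split=> //=.
rewrite -[F in F --> _](retract_fmap (GL_one R n) _ FE).
exact: cvg_set_val.
Qed.

Lemma GL_mul_continuousl (B : GL R n) : continuous (GL_mul B).
Proof.
move=> A; have BA : val B *m val M @[M --> A] --> val B *m val A.
  apply: (cvg_mulmx (FF := nbhs_filter A)); first exact: cvg_cst.
  exact: GL_val_continuous.
exact: (cvg_set_val (nbhs_filter A) (f := GL_mul B) (s := GL_mul B A)).
Qed.

Lemma GL_mul_continuousr (B : GL R n) : continuous (fun A => GL_mul A B).
Proof.
move=> A; have BA : val M *m val B @[M --> A] --> val A *m val B.
  apply: (cvg_mulmx (FF := nbhs_filter A)); last exact: cvg_cst.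
  exact: GL_val_continuous.
exact: (cvg_set_val (nbhs_filter A) (f := fun M => GL_mul M B) (s := GL_mul A B)).
Qed.

Lemma PGL_of_continuous : continuous (@PGL_of R n).
Proof. exact: pi_continuous. Qed.

Lemma PGL_openP (O : set (PGL R n)) : open O <-> open (@PGL_of R n @^-1` O).
Proof. by []. Qed.

Lemma PGL_mul_continuousl (g : PGL R n) : continuous (fun h : PGL R n => (g * h)%g).
Proof.
have gE A : (g * PGL_of A)%g = PGL_of (GL_mul (repr g) A).
  by rewrite -PGL_of_mul PGL_ofK.
apply/continuousP => O oO; apply/PGL_openP.
rewrite (_ : _ @^-1` _ = GL_mul (repr g) @^-1` (@PGL_of R n @^-1` O)).
  by move/continuousP: (@GL_mul_continuousl (repr g)); apply; apply/PGL_openP.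
by apply/seteqP; split=> A /=; rewrite gE.
Qed.

Lemma PGL_mul_continuousr (g : PGL R n) : continuous (fun h : PGL R n => (h * g)%g).
Proof.
have gE A : (PGL_of A * g)%g = PGL_of (GL_mul A (repr g)).
  by rewrite -PGL_of_mul PGL_ofK.
apply/continuousP => O oO; apply/PGL_openP.
rewrite (_ : _ @^-1` _ = (fun A => GL_mul A (repr g)) @^-1` (@PGL_of R n @^-1` O)).
  by move/continuousP: (@GL_mul_continuousr (repr g)); apply; apply/PGL_openP.
by apply/seteqP; split=> A /=; rewrite gE.
Qed.

Lemma PGL_conj_continuous (g : PGL R n) : continuous (fun h : PGL R n => (h ^ g)%g).
Proof.
move=> h; apply: (@continuous_comp _ _ _ (fun k : PGL R n => (k * g)%g) (fun k
  : PGL R n => (g^-1 * k)%g)).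
  exact: PGL_mul_continuousr.
exact: PGL_mul_continuousl.
Qed.

End ProjectiveGroup.

(** * The automorphism group and its identity component *)

Section Component.
Context {R : realType} (Pi : parallelism R) (Pi_top : topological_parallelism Pi).
Local Notation Phi := (Aut_par Pi).
Local Notation Phi1 := (Aut_par1 Pi).

Lemma Aut_par_1 : Phi 1%g.
Proof. by move=> L M; rewrite !PGL_act1. Qed.

Lemma aut_GL_repr g : Phi g -> aut_GL Pi (repr g).
Proof. by move=> Pg; apply/aut_GLP; rewrite PGL_ofK. Qed.

Lemma Aut_par_M g h : Phi g -> Phi h -> Phi (g * h)%g.
Proof.
by move=> /aut_GL_repr ag /aut_GL_repr ah;
  exact: (aut_GLP _ _).1 (aut_GL_mul ag ah).
Qed.

Lemma Aut_par_V g : Phi g -> Phi (g^-1)%g.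
Proof. by move=> /aut_GL_repr ag; exact: (aut_GLP _ _).1 (aut_GL_inv ag). Qed.

(** Images of a fixed pair of parallels under converging matrices converge, and parallelism is a
    closed relation; the quotient topology allows the check to be made in GL. *)
Lemma Aut_par_closed : closed Phi.
Proof.
rewrite -openC; apply/PGL_openP; rewrite -preimage_setC openC.
have -> : @PGL_of R 4 @^-1` Phi = [set A | aut_GL Pi A].
  by apply/seteqP; split=> A PA; [exact: (aut_GLP Pi A).2 PA|exact: (aut_GLP Pi
    A).1 PA].
set E := [set A | _] => A clA L M LM.
have pF := within_nbhs_proper clA; set F := within E (nbhs A) in pF.
have FE : F E by exact: withinT.
have aut1 : E (GL_one R 4) by move=> ? ?; rewrite !GL_act1.
pose f := retract E (GL_one R 4).
have fA : f t @[t --> F] --> A.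
  by rewrite [f @ F]retract_fmap//; exact: cvg_within.
have vA : val (f t) @[t --> F] --> val A.
  exact: (cvg_comp _ _ fA (@GL_val_continuous R 4 A)).
have cact (N : pg_line R) : GL_act (f t) N @[t --> F] --> GL_act A N.
  have [B _ NB] := mem_grass_frame N.
  have cB : val (f t) *m B @[t --> F] --> val A *m B.
    by apply: cvg_mulmx => //; exact: cvg_cst.
  by apply: (cvg_grass cB) => [t|]; exact: GL_act_cols.
have [x x0 xL] := line_neq0 L.
have Ax0 (B : GL R 4) : val B *m x != 0.
  by apply: contra_neq x0; apply: unit_mulmx_eq0; exact: Defs.GL_unit.
have cx : val (f t) *m x @[t --> F] --> val A *m x.
  by apply: cvg_mulmx => //; exact: cvg_cst.
have aL t : Pi (GL_act (f t) L) (GL_act (f t) M) by exact: (retractP t aut1).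
have xf t : val (f t) *m x \in val (GL_act (f t) L) by exact: GL_act_mem.
exact: (parallel_cvg Pi_top pF (cact L) (cact M) cx aL xf (fun t => Ax0 (f t))
  (Ax0 A)).
Qed.

Lemma Aut_par1_closed : closed Phi1.
Proof. exact: component_closed Aut_par_closed. Qed.

Lemma Aut_par1_1 : Phi1 1%g.
Proof. exact: connected_component_refl Aut_par_1. Qed.

(** The translate of the component by the inverse of [g] is connected, lies in the group and
    contains 1. *)
Lemma Aut_par1_VM g h : Phi1 g -> Phi1 h -> Phi1 (g^-1 * h)%g.
Proof.
move=> g1 h1; have gPhi := connected_component_sub g1.
suff : (fun k => g^-1 * k)%g @` Phi1 `<=` Phi1 by apply; exists h.
apply: connected_component_max.
- by exists g; rewrite ?mulVg.
- move=> _ [k /connected_component_sub kPhi <-].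
  by apply: Aut_par_M => //; exact: Aut_par_V.
- apply: connected_continuous_connected; first exact: component_connected.
  by apply: continuous_subspaceT; exact: PGL_mul_continuousl.
Qed.

Lemma Aut_par1_group : group_closed (mem Phi1).
Proof.
split; first by rewrite inE; exact: Aut_par1_1.
move=> g h; rewrite !inE => g1 h1.
have V k : Phi1 k -> Phi1 (k^-1)%g.
  by move=> k1; rewrite -[(k^-1)%g]mulg1; apply: Aut_par1_VM => //;
    exact: Aut_par1_1.
by rewrite -[g]invgK; apply: Aut_par1_VM; exact: V.
Qed.

(* The sign of the determinant is well defined on PGL(4), as 4 is even. *)
Lemma Aut_par1_det (A : GL R 4) : Phi1 (PGL_of A) -> 0 < \det (val A).
Proof.
pose P := [set g : PGL R 4 | 0 < \det (val (repr g))].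
have PP (B : GL R 4) : P (PGL_of B) <-> 0 < \det (val B).
  rewrite /P/=; have [c c0 ->] := repr_PGL_of B.
  by rewrite detZ pmulr_rgt0// exprn_even_gt0// c0 orbT.
have dc : continuous (fun B : GL R 4 => \det (val B)).
  by move=> B; exact: (cvg_det (FF := nbhs_filter B) (@GL_val_continuous R 4 B)).
have oP : open P.
  apply/PGL_openP; rewrite (_ : _ @^-1` _ = (fun B : GL R 4 => \det (val B))
    @^-1` [set y | y > 0]).
    by move/continuousP: dc; apply; exact: open_gt.
  by apply/seteqP; split=> B /PP.
have cP : closed P.
  rewrite -openC; apply/PGL_openP.
  rewrite (_ : _ @^-1` _ = (fun B : GL R 4 => \det (val B)) @^-1` [set y | y < 0]).
    by move/continuousP: dc; apply; exact: open_lt.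
  apply/seteqP; split=> B /=.
    move=> nP; rewrite lt_neqAle; apply/andP; split.
      by rewrite -unitfE -unitmxE Defs.GL_unit.
    by rewrite leNgt; apply/negP => /PP.
  by move=> lt0 /PP gt0; have := lt_trans lt0 gt0; rewrite ltxx.
(* [P] is open and closed and contains 1, so it cuts out all of the connected set [Phi1]. *)
have := @component_connected _ Phi 1%g (Phi1 `&` P).
move=> /(_ _ _ _) E; move=> /[dup] A1; rewrite -[X in X _ -> _]E.
- by move=> -[_ /PP].
- exists 1%g; split; first exact: Aut_par1_1.
  by apply/PP; rewrite /= det1.
- by exists P.
- by exists P.
Qed.

(** A scalar c multiplies the determinant by its fourth power, hence the iterated square root; the
    sign cannot be changed in this way. *)
Lemma PGL_normalize (g : PGL R 4) : exists2 A : GL R 4, g = PGL_of A & `|\det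
  (val A)| = 1.
Proof.
have d0 : 0 < `|\det (val (repr g))|.
  by rewrite normr_gt0 -unitfE -unitmxE Defs.GL_unit.
set d := `|_| in d0; pose c := (Num.sqrt (Num.sqrt d))^-1.
have c0 : c != 0 by rewrite invr_eq0 gt_eqF// !sqrtr_gt0.
have uA : c *: val (repr g) \in unitmx by rewrite unitmxZ ?Defs.GL_unit ?unitfE.
exists (mkGL uA).
  rewrite -{1}(PGL_ofK g); apply/PGL_ofP/asboolP.
  exists c^-1; first by rewrite invr_eq0.
  by rewrite -[RHS]/(c^-1 *: (c *: val (repr g))) scalerA mulVf// scale1r.
rewrite /= detZ normrM -/d normrX (exprM _ 2 2) ger0_norm ?invr_ge0 ?sqrtr_ge0//.
by rewrite !exprVn sqr_sqrtr ?sqrtr_ge0// sqr_sqrtr ?ltW// mulVf// gt_eqF.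
Qed.

End Component.

Theorem theorem1p1 (R : realType) (Pi : parallelism R)
    (Pi_top : topological_parallelism Pi) :
  compact (Aut_par1 Pi) /\
  exists (g : PGL R 4) (H : set (PGL R 4)),
    [/\ group_closed (mem H), closed H, connected H, H `<=` PSO R 4 &
        [set (h ^ g)%g | h in Aut_par1 Pi] = H].
Proof.
have [K bd] := aut_GL_bounded Pi_top.
have aut1 : aut_GL Pi (GL_one R 4) by move=> L M; rewrite !GL_act1.
have rep g : Aut_par1 Pi g -> exists A : GL R 4,
    [/\ g = PGL_of A, aut_GL Pi A & `|\det (val A)| = 1].
  move=> g1; have [A gA dA] := PGL_normalize g; exists A; split=> //.
  by apply/aut_GLP; rewrite -gA; exact: connected_component_sub g1.
split.
  have K1 i j : `|(1%:M : 'M[R]_4) i j| <= K.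
    apply: le_trans (entry_le_norm _ _ _) _.
    by apply: (bd (GL_one R 4) aut1); rewrite /= det1 normr1.
  have cK := continuous_compact (continuous_subspaceT (@PGL_of_continuous R 4))
    (GL_norm_compact K1).
  apply: (subclosed_compact (Aut_par1_closed Pi_top) cK) => g /rep[A [-> aA dA]].
  exists A => //; split=> // i j.
  by apply: le_trans (entry_le_norm _ _ _) _; exact: bd.
pose G : set 'M[R]_4 :=
  [set M | exists A : GL R 4, [/\ val A = M, aut_GL Pi A & `|\det (val A)| = 1]].
have [|||||Q [Qs Qp Qi]] := @invariant_form R 4 G K.
- by exists (GL_one R 4); split; rewrite //= det1 normr1.
- move=> _ _ [A [<- aA dA]] [B [<- aB dB]]; exists (GL_mul A B).
  by split=> //; [exact: aut_GL_mul|rewrite /= det_mulmx normrM dA dB mulr1].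
- by move=> _ [A [<- _ _]]; exact: Defs.GL_unit.
- move=> _ [A [<- aA dA]]; exists (GL_inv A).
  by split=> //; [exact: aut_GL_inv|rewrite /= det_inv normfV dA invr1].
- by move=> _ [A [<- aA dA]]; exact: bd.
have [S uS QS] := cholesky Qs Qp.
(* Since [(h ^ g)%g] stands for the product of [g^-1], [h] and [g], taking for [g] the inverse of
   the class of [S] conjugates A into S A S^-1, which preserves the standard form. *)
pose g : PGL R 4 := PGL_inv (PGL_of (mkGL uS)).
exists g, [set (h ^ g)%g | h in Aut_par1 Pi]; split=> //.
- have [G1 GB] := Aut_par1_group Pi; split.
    by rewrite inE; exists 1%g; [exact: Aut_par1_1|rewrite conj1g].
  move=> x y; rewrite !inE => -[h h1 <-] [k k1 <-]; exists (h * k^-1)%g.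
    by have := GB h k; rewrite !inE; exact.
  by rewrite conjMg conjVg.
- rewrite (_ : [set _ | _ in _] = (fun h => h ^ (g^-1))%g @^-1` Aut_par1 Pi).
    move/continuous_closedP: (@PGL_conj_continuous R 4 (g^-1)%g); apply.
    exact: Aut_par1_closed.
  apply/seteqP; split=> [_ [h h1 <-]|h h1] /=; first by rewrite conjgK.
  by exists (h ^ (g^-1))%g; rewrite ?conjgKV.
- apply: connected_continuous_connected; first exact: component_connected.
  by apply: continuous_subspaceT; exact: PGL_conj_continuous.
move=> _ [h h1 <-]; have [A [hA aA dA]] := rep _ h1.
have detA : \det (val A) = 1.
  have pos : 0 < \det (val A) by apply: (@Aut_par1_det _ Pi); rewrite -hA.
  by rewrite -dA gtr0_norm.
have uSi : invmx S \in unitmx by rewrite unitmx_inv.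
exists (GL_mul (mkGL uS) (GL_mul A (GL_inv (mkGL uS)))); last first.
  rewrite hA /g [RHS]conjgE invgK.
  by rewrite -!PGL_of_mul PGL_of_inv.
split; last by rewrite /= !det_mulmx det_inv detA mul1r mulrV// -unitmxE.
have QA : (val A)^T *m Q *m val A = Q by apply: Qi; exists A.
(* Invariance of [Q] makes the transpose a left inverse, while [SO] asks for a right inverse. *)
apply: mulmx1C; rewrite /= !trmx_mul trmx_inv.
rewrite -!mulmxA (mulmxA S^T S) -QS !mulmxA.
rewrite -(mulmxA _ _ Q) -(mulmxA _ _ (val A)) QA QS !mulmxA mulVmx ?unitmx_tr//
  mul1mx.
by rewrite mulmxV.
Qed.
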